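(* Let $R$ be an integral domain. The following conditions are equivalent: (i) $R$ is integrally closed and $w$-stable; (ii) $R$ is a $w$-stable P$v$MD; (iii) $R$ is a strongly discrete P$v$MD with $t$-finite character; (iv) $R$ is a generalized Krull domain with $t$-finite character; (v) $R$ is a $w$-stable generalized Krull domain; (vi) $R$ is a P$v$MD with $t$-finite character and each $t$-prime ideal of $R$ is $w$-stable; (vii) $R$ is $w$-stable and each $t$-maximal ideal of $R$ is $t$-invertible.
   Context: $R$ is an integral domain with quotient field $K\neq R$. For nonzero $R$-submodules $A,B$ of $K$, $(A:B)=\{x\in K: xB\subseteq A\}$; $E(I)=(I:I)$. For a nonzero fractional ideal $I$, $I_v=(R:(R:I))$, $I_t=\bigcup\{J_v: J\subseteq I\text{ nonzero finitely generated}\}$ ($I$ a $t$-ideal if $I=I_t$); $t$-primes are prime $t$-ideals; $t\text{-Max}(R)$ is the set of ideals maximal among proper $t$-ideals. $I$ is $t$-invertible if $(I(R:I))_t=R$. For a nonzero $R$-submodule $E$ of $K$, $E_w=\bigcap_{M\in t\text{-Max}(R)}ER_M$; $I$ is a $w$-ideal if $I=I_w$. A $w$-ideal $I$ is $w$-stable if $(I(E(I):I))_w=E(I)$; $R$ is $w$-stable if every $w$-ideal is $w$-stable. $R$ has $t$-finite character if each nonzero element lies in only finitely many $t$-maximal ideals. $R$ is a P$v$MD if $R_M$ is a valuation domain for each $M\in t\text{-Max}(R)$; a P$v$MD is strongly discrete if $(P^2)_t\neq P$ for each $t$-prime $P$. A generalized Krull domain is a strongly discrete P$v$MD satisfying the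 ascending chain condition on radical $t$-ideals. *)

(* Defs.v *)
From mathcomp Require Import all_boot all_algebra.
Set Implicit Arguments. Unset Strict Implicit. Unset Printing Implicit Defensive.
Import GRing.Theory.
Local Open Scope ring_scope.

(* Setting: R is a subring (integral domain) of a field K, given as a
   predicate on K, with K the quotient field of R.  R-submodules of K are
   predicates on K. *)
Section Defs.
Variable K : fieldType.
Implicit Types (R A B I J E M N P : K -> Prop).

Definition subset A B := forall x, A x -> B x.
Definition seteq A B := forall x, A x <-> B x.

Definition subring R :=
  R 0 /\ R 1 /\ (forall x y, R x -> R y -> R (x - y)) /\
  (forall x y, R x -> R y -> R (x * y)).

Definition quotient_field R :=
  forall x, exists a b, R a /\ R b /\ b != 0 /\ x = a / b.

Definition submodule R A :=
  A 0 /\ (forall x y, A x -> A y -> A (x + y)) /\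
  (forall r x, R r -> A x -> A (r * x)).

Definition nonzero A := exists x, A x /\ x != 0.

Definition frac_ideal R I :=
  submodule R I /\ nonzero I /\
  exists d, R d /\ d != 0 /\ forall x, I x -> R (d * x).

Definition colon A B : K -> Prop := fun x => forall b, B b -> A (x * b).
Definition Eend I := colon I I.

Definition prod A B : K -> Prop := fun x =>
  exists n (a b : 'I_n -> K), (forall i, A (a i)) /\ (forall i, B (b i)) /\
    x = \sum_(i < n) a i * b i.

Fixpoint span R (s : seq K) : K -> Prop :=
  match s with
  | [::] => fun x => x = 0
  | a :: s' => fun x => exists r y, R r /\ span R s' y /\ x = r * a + y
  end.

Definition fin_gen R J := exists s, seteq J (span R s).

Definition vclos R I := colon R (colon R I).

Definition tclos R I : K -> Prop := fun x =>
  exists J, nonzero J /\ fin_gen R J /\ subset J I /\ vclos R J x.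

Definition ideal R I := submodule R I /\ subset I R.
Definition proper I := ~ I 1.

Definition t_ideal R I := ideal R I /\ nonzero I /\ seteq I (tclos R I).

Definition prime_ideal R P :=
  ideal R P /\ proper P /\
  forall x y, R x -> R y -> P (x * y) -> P x \/ P y.

Definition t_prime R P := prime_ideal R P /\ t_ideal R P.

Definition t_max R M :=
  t_ideal R M /\ proper M /\
  forall N, t_ideal R N -> proper N -> subset M N -> seteq N M.

Definition t_invertible R I := seteq (tclos R (prod I (colon R I))) R.

Definition loc R M : K -> Prop := fun x =>
  exists a s, R a /\ R s /\ ~ M s /\ x = a / s.

Definition wclos R E : K -> Prop := fun x =>
  forall M, t_max R M -> prod E (loc R M) x.

Definition w_ideal R I := frac_ideal R I /\ seteq I (wclos R I).

Definition w_stable_ideal R I :=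
  w_ideal R I /\ seteq (wclos R (prod I (colon (Eend I) I))) (Eend I).

Definition w_stable R := forall I, w_ideal R I -> w_stable_ideal R I.

Definition integrally_closed R :=
  forall x, (exists p : {poly K}, p \is monic /\ (forall i, R p`_i) /\ root p x) ->
  R x.

Definition valuation_ring (V : K -> Prop) := forall x : K, x != 0 -> V x \/ V x^-1.

Definition PvMD R := forall M, t_max R M -> valuation_ring (loc R M).

Definition strongly_discrete R :=
  PvMD R /\ forall P, t_prime R P -> ~ seteq (tclos R (prod P P)) P.

Definition radical R I := forall x n, R x -> I (x ^+ n.+1) -> I x.

Definition acc_radical_t R :=
  forall I : nat -> K -> Prop,
    (forall n, t_ideal R (I n) /\ radical R (I n)) ->
    (forall n, subset (I n) (I n.+1)) ->
    exists n, forall m, (n <= m)%N -> seteq (I m) (I n).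

Definition gen_Krull R := strongly_discrete R /\ acc_radical_t R.

Definition t_finite_character R :=
  forall x, R x -> x != 0 ->
  exists n (f : 'I_n -> K -> Prop),
    forall M, t_max R M -> M x -> exists i, seteq M (f i).

End Defs.

(* Main.v *)
Require Import Defs.
From mathcomp Require Import all_boot all_algebra.
From mathcomp Require Import ring.
From mathcomp Require Import boolp.
From mathcomp Require classical_sets.
Import Defs.

(** Everything is checked at the localizations [R_M], [M] t-maximal, because
    [R] and every t-ideal are the intersections of their localizations.
    - If [R] is integrally closed, [E(J_w) = R] for [J = (a, b)], so stability makes
      [J R_M] principal and [R_M] a valuation domain.
    - If the t-maximal ideals are t-invertible, [R_M] has principal maximal ideal,
      and a stable local domain with principal maximal ideal is a valuation domain;
      t-finite character comes from stability of the sum of the [(R : M)] over the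
      [M] containing a given element.
    - A t-prime [P] of a PvMD with [(P^2)_t = P] cannot be w-stable, since then
      [P (E(P) : P)] would be contained in [P R_M] for [M] containing [P].
    - In a strongly discrete PvMD, [I R_M] is principal over its endomorphism ring;
      finite character turns these local generators into w-stability, and turns
      stabilization of the chains of primes of the [R_M] into the chain condition. *)

Set Implicit Arguments. Unset Strict Implicit. Unset Printing Implicit Defensive.
Import GRing.Theory.

(** * Submodules, products, colons and finite spans *)

Section Products.
Local Open Scope ring_scope.
Variable K : fieldType.
Implicit Types (R A B C I J E M N P : K -> Prop) (s : seq K).

Lemma subr_0 R : subring R -> R 0. Proof. by case. Qed.
Lemma subr_1 R : subring R -> R 1. Proof. by case=> _ []. Qed.
Lemma subr_B R : subring R -> forall x y, R x -> R y -> R (x - y).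
Proof. by case=> _ [_ []]. Qed.
Lemma subr_M R : subring R -> forall x y, R x -> R y -> R (x * y).
Proof. by case=> _ [_ []]. Qed.
Lemma subr_N R : subring R -> forall x, R x -> R (- x).
Proof. by move=> HR x Rx; rewrite -sub0r; apply: subr_B => //; apply: subr_0. Qed.
Lemma subr_D R : subring R -> forall x y, R x -> R y -> R (x + y).
Proof. by move=> HR x y Rx Ry; rewrite -[y]opprK; apply: subr_B => //; apply: subr_N. Qed.

Lemma submod_0 R A : submodule R A -> A 0. Proof. by case. Qed.
Lemma submod_D R A : submodule R A -> forall x y, A x -> A y -> A (x + y).
Proof. by case=> _ []. Qed.
Lemma submod_Z R A : submodule R A -> forall r x, R r -> A x -> A (r * x).
Proof. by case=> _ []. Qed.
Lemma submod_B R A : subring R -> submodule R A -> forall x y, A x -> A y -> A (x - y).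
Proof.
move=> HR HA x y Ax Ay; apply: (submod_D HA) => //; rewrite -mulN1r.
by apply: (submod_Z HA) => //; apply: subr_N => //; apply: subr_1.
Qed.

Lemma subring_submodule R : subring R -> submodule R R.
Proof.
by move=> HR; split; [exact: subr_0 | split; [exact: subr_D | exact: subr_M]].
Qed.

Lemma nonzero_fraction R : subring R -> quotient_field R ->
  forall x, exists a b, R a /\ R b /\ b != 0 /\ b * x = a.
Proof.
move=> HR HQ x; have [a [b [Ra [Rb [b0 ->]]]]] := HQ x.
by exists a, b; do 3!split => //; rewrite mulrCA divff ?mulr1.
Qed.

Lemma prod_mul A B a b : A a -> B b -> prod A B (a * b).
Proof.
move=> Aa Bb; exists 1%N, (fun=> a), (fun=> b); do 2!split => //.
by rewrite big_ord1.
Qed.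

Lemma prod_sub A B C : C 0 -> (forall x y, C x -> C y -> C (x + y)) ->
  (forall a b, A a -> B b -> C (a * b)) -> subset (prod A B) C.
Proof.
move=> C0 CD CM x [n [a [b [Aa [Bb ->]]]]].
by apply: big_ind => // i _; apply: CM.
Qed.

Lemma prod_submodule R A B : submodule R A -> submodule R (prod A B).
Proof.
move=> HA; split.
  exists 0%N, (fun=> 0), (fun=> 0); split; first by case.
  by split; [case|rewrite big_ord0].
split=> [x y [n [a [b [Aa [Bb ->]]]]] [m [c [d [Ac [Bd ->]]]]]|
         r x Rr [n [a [b [Aa [Bb ->]]]]]].
  exists (n + m)%N, (fun i => match split i with inl j => a j | inr j => c j end),
    (fun i => match split i with inl j => b j | inr j => d j end).
  do 2?[split; first by move=> i; case: (split i)].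
  rewrite big_split_ord; congr (_ + _); apply: eq_bigr => i _.
    by rewrite (unsplitK (inl i) : split (lshift m i) = inl i).
  by rewrite (unsplitK (inr i) : split (rshift n i) = inr i).
exists n, (fun i => r * a i), b; split=> [i|]; first by apply: (submod_Z HA).
by split => //; rewrite mulr_sumr; apply: eq_bigr => i _; rewrite mulrA.
Qed.

Lemma prod_mono A B A' B' : subset A A' -> subset B B' -> subset (prod A B) (prod A' B').
Proof.
move=> AA BB x [n [a [b [Aa [Bb ->]]]]]; exists n, a, b.
by split=> [i|]; [exact: AA | split=> // i; exact: BB].
Qed.

Lemma colon_submodule R A B : submodule R A -> submodule R (colon A B).
Proof.
move=> HA; split; first by move=> b _; rewrite mul0r; apply: submod_0 HA.
split=> [x y Ax Ay b Bb|r x Rr Ax b Bb].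
  by rewrite mulrDl; apply: (submod_D HA); [apply: Ax|apply: Ay].
by rewrite -mulrA; apply: (submod_Z HA) => //; apply: Ax.
Qed.

Lemma span_submodule R s : subring R -> submodule R (span R s).
Proof.
move=> HR; elim: s => [|a s IH] /=.
  by split=> //; split=> [x y -> ->|r x _ ->]; rewrite ?addr0 ?mulr0.
split.
  exists 0, 0; rewrite mul0r addr0; split; first exact: subr_0.
  by split=> //; apply: submod_0 IH.
split=> [x y [r [z [Rr [Sz ->]]]] [r' [z' [Rr' [Sz' ->]]]]|r x Rr [t [z [Rt [Sz ->]]]]].
  exists (r + r'), (z + z'); split; first exact: subr_D.
  by split; [apply: (submod_D IH)|ring].
exists (r * t), (r * z); split; first exact: subr_M.
by split; [apply: (submod_Z IH)|ring].
Qed.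

Lemma span_mem R s a : subring R -> a \in s -> span R s a.
Proof.
move=> HR; elim: s => //= b s IH; rewrite inE => /orP[/eqP <-|/IH sa].
  exists 1, 0; split; first exact: subr_1.
  by split; [apply: submod_0 (span_submodule s HR)|rewrite mul1r addr0].
by exists 0, a; split; [exact: subr_0|rewrite mul0r add0r].
Qed.

Lemma span_sub R s A : submodule R A -> (forall a, a \in s -> A a) ->
  subset (span R s) A.
Proof.
move=> HA; elim: s => /= [_ x ->|a s IH sA x [r [y [Rr [sy ->]]]]].
  exact: submod_0 HA.
apply: (submod_D HA).
  by apply: (submod_Z HA) => //; apply: sA; rewrite mem_head.
by apply: IH => // b bs; apply: sA; rewrite inE bs orbT.
Qed.

End Products.

(** * The t-closure and t-maximal ideals *)

Section TClosure.
Local Open Scope ring_scope.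
Variables (K : fieldType) (R : K -> Prop).
Hypotheses (HR : subring R) (HQ : quotient_field R).
Implicit Types (A B C I J E M N P : K -> Prop) (s : seq K).

(* [J_v] is unfolded over a finite generating set [s] of [J]; on nonzero
   submodules [tcl] is the t-closure. *)
Definition tcl I : K -> Prop := fun x =>
  exists s, (forall a, a \in s -> I a) /\
    forall y, (forall a, a \in s -> R (y * a)) -> R (x * y).

Lemma tclosE I : submodule R I -> nonzero I -> seteq (tclos R I) (tcl I).
Proof.
move=> HI [i [Ii i0]] x; split.
  case=> J [_ [[s sJ] [JI Jx]]]; exists s; split=> [a sa|y sy].
    by apply/JI/sJ/span_mem.
  apply: Jx => a /sJ; apply: (span_sub (A := fun a => R (y * a))) => //.
  split; first by rewrite mulr0; apply: subr_0.
  split=> [u v|r u Rr]; first by rewrite mulrDr; apply: subr_D.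
  by rewrite mulrCA; apply: subr_M.
case=> s [sI sx]; exists (span R (i :: s)); split.
  by exists i; split=> //; apply: span_mem; rewrite ?mem_head.
split; first by exists (i :: s).
split; first by apply: span_sub => // a; rewrite inE => /orP[/eqP->|/sI].
move=> y sy; apply: sx => a sa; apply: sy.
by apply: span_mem; rewrite // inE sa orbT.
Qed.

Lemma sub_tcl I : subset I (tcl I).
Proof.
move=> x Ix; exists [:: x]; split=> [a|y sy]; first by rewrite inE => /eqP->.
by rewrite mulrC; apply: sy; rewrite mem_head.
Qed.

Lemma tcl_mono I J : subset I J -> subset (tcl I) (tcl J).
Proof. by move=> IJ x [s [sI sx]]; exists s; split=> // a /sI /IJ. Qed.

(** Finitely many elements of the t-closure involve only finitely many elements of [I]: their
    witnessing lists are concatenated. *)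
Lemma tcl_idem I : subset (tcl (tcl I)) (tcl I).
Proof.
move=> x [s [sI sx]].
have [t [tI ts]] : exists t : seq K, (forall a, a \in t -> I a) /\
    forall y, (forall a, a \in t -> R (y * a)) -> forall a, a \in s -> R (y * a).
  elim: s sI {sx} => [_|a s IH sI]; first by exists [::].
  have [|t [tI ts]] := IH; first by move=> b bs; apply: sI; rewrite inE bs orbT.
  have [u [uI ux]] := sI _ (mem_head a s).
  exists (u ++ t); split=> [b|y Ry b]; first by rewrite mem_cat => /orP[/uI|/tI].
  rewrite inE => /orP[/eqP->|bs].
    by rewrite mulrC; apply: ux => c cu; apply: Ry; rewrite mem_cat cu.
  by apply: ts => // c ct; apply: Ry; rewrite mem_cat ct orbT.
by exists t; split=> // y Ry; apply: sx => a sa; apply: ts.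
Qed.

Lemma tcl_submodule I : submodule R (tcl I).
Proof.
split; first by exists [::]; split=> // y _; rewrite mul0r; apply: subr_0.
split=> [x y [s [sI sx]] [t [tI ty]]|r x Rr [s [sI sx]]].
  exists (s ++ t); split=> [a|z Rz]; first by rewrite mem_cat => /orP[/sI|/tI].
  rewrite mulrDl; apply: subr_D => //.
    by apply: sx => a sa; apply: Rz; rewrite mem_cat sa.
  by apply: ty => a ta; apply: Rz; rewrite mem_cat ta orbT.
by exists s; split=> // y Ry; rewrite -mulrA; apply: subr_M => //; apply: sx.
Qed.

(** Applied later at [x = 1], to pass from [1] in the t-closure of [I] to [c] in that of [J]. *)
Lemma tcl_scale I J c x : (forall a, I a -> J (c * a)) -> tcl I x -> tcl J (c * x).
Proof.
move=> IJ [s [sI sx]]; exists [seq c * a | a <- s]; split=> [_ /mapP[a /sI Ia ->]|y Ry].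
  exact: IJ.
have -> : c * x * y = x * (y * c) by ring.
by apply: sx => a sa; rewrite -mulrA; apply/Ry/map_f.
Qed.

Lemma tcl_sub_ring I : subset I R -> subset (tcl I) R.
Proof.
move=> IR x [s [sI sx]]; rewrite -[x]mulr1.
by apply: sx => a /sI /IR; rewrite mul1r.
Qed.

Lemma t_idealE I : t_ideal R I <-> ideal R I /\ nonzero I /\ subset (tcl I) I.
Proof.
split=> -[HI [I0 It]]; split=> //; split=> // x.
  by move/(tclosE HI.1 I0)/It.
split=> [Ix|/(tclosE HI.1 I0)/It//].
by apply/(tclosE HI.1 I0)/sub_tcl.
Qed.

Lemma t_ideal_tcl I : ideal R I -> nonzero I -> t_ideal R (tcl I).
Proof.
move=> [_ IR] [i [Ii i0]]; apply/t_idealE; split.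
  by split; [exact: tcl_submodule|exact: tcl_sub_ring].
split; last exact: tcl_idem.
by exists i; split=> //; apply: sub_tcl.
Qed.

(* Zorn's lemma is applied to the family enlarged by the empty set, which takes
   care of the empty chain. *)
Lemma t_max_exists I : t_ideal R I -> proper I ->
  exists M, t_max R M /\ subset I M.
Proof.
move=> tI pI; pose Q (X : K -> Prop) := (forall x, ~ X x) \/
  (t_ideal R X /\ proper X /\ subset I X).
have [F FQ Ftot|M [QM maxM]] := @classical_sets.Zorn_bigcup K Q.
  have [[X0 [FX0 [x0 X0x0]]]|nF] := EM (exists X, F X /\ exists x, X x); last first.
    by left=> x [X FX Xx]; apply: nF; exists X; split=> //; exists x.
  have FQ' X x : F X -> X x -> t_ideal R X /\ proper X /\ subset I X.
    by move=> FX Xx; case: (FQ _ FX) => // /(_ x).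
  have [tX0 [pX0 IX0]] := FQ' _ _ FX0 X0x0.
  right; split; last first.
    split=> [[X FX X1]|x Ix]; first by have [_ []] := FQ' _ _ FX X1.
    by exists X0 => //; apply: IX0.
  apply/t_idealE; split; [split; first split|split].
  - by exists X0 => //; case: tX0 => -[HX _] _; apply: submod_0 HX.
  - split=> [x y [X FX Xx] [Y FY Yy]|r x Rr [X FX Xx]].
      have [XY|YX] := Ftot _ _ FX FY.
        exists Y => //; have [[[HY _] _] _] := FQ' _ _ FY Yy.
        by apply: (submod_D HY) => //; apply: XY.
      exists X => //; have [[[HX _] _] _] := FQ' _ _ FX Xx.
      by apply: (submod_D HX) => //; apply: YX.
    exists X => //; have [[[HX _] _] _] := FQ' _ _ FX Xx.
    exact: (submod_Z HX).
  - by move=> x [X FX Xx]; have [[[_ XR] _] _] := FQ' _ _ FX Xx; apply: XR.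
  - case: tX0 => _ [[x [Xx x_neq0]] _].
    by exists x; split=> //; exists X0.
  - move=> x [s [sU sx]].
    (* As [s] is finite and [F] is a chain, a single member of [F] contains all of [s]. *)
    suff [X [FX [[z Xz] sX]]] : exists X, F X /\ (exists z, X z) /\ forall a, a \in s -> X a.
      exists X => //; have [tX _] := FQ' _ _ FX Xz.
      by have [_ [_]] := (t_idealE X).1 tX; apply; exists s.
    elim: s sU {sx} => [_|a s IH sU]; first by exists X0; do 2!split=> //; exists x0.
    have [|X [FX [Xz sX]]] := IH; first by move=> b bs; apply: sU; rewrite inE bs orbT.
    have [Y FY Ya] := sU _ (mem_head a s).
    have [XY|YX] := Ftot _ _ FX FY.
      exists Y; do 2?split=> //; first by exists a.
      by move=> b; rewrite inE => /orP[/eqP->|/sX /XY].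
    exists X; do 2!split=> //.
    by move=> b; rewrite inE => /orP[/eqP->|/sX//]; apply: YX.
have {QM} [tM [pM IM]] : t_ideal R M /\ proper M /\ subset I M.
  case: QM => // M0; have QI : Q I by right; split=> //; split=> // y.
  case: (maxM I _ QI).
  split=> [x /M0//|IM]; case: tI => -[HI _] _.
  by apply: (M0 0); apply: IM; apply: submod_0 HI.
exists M; split=> //; split=> //; split=> // N tN pN MN x.
split=> [Nx|]; last exact: MN.
apply: contrapT => nMx.
have QN : Q N by right; split=> //; split=> // y /IM /MN.
case: (maxM N _ QN).
by split=> // NM; apply/nMx/NM.
Qed.

(** Otherwise the t-closure of [A] would be a proper t-ideal and lie in a t-maximal one. The
    conclusion supplies a finite list of elements of [A], turning local data into finite data. *)
Lemma t_max_covers A : ideal R A -> nonzero A ->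
  (forall M, t_max R M -> exists a, A a /\ ~ M a) -> tcl A 1.
Proof.
move=> HA A0 Acov; apply: contrapT => nA1.
have [M [tM AM]] := t_max_exists (t_ideal_tcl HA A0) nA1.
by have [a [Aa]] := Acov M tM; apply; apply/AM/sub_tcl.
Qed.

Lemma t_max_no_unit M A : t_max R M -> subset A M -> ~ tcl A 1.
Proof.
move=> [/t_idealE [_ [_ tM]] [pM _]] AM A1.
by apply/pM/tM/(tcl_mono AM).
Qed.

(** If [x] is outside [M], maximality puts [1] in the t-closure of [A = M + x R]. Multiplication by
    [y] sends [A] into [M], so [y] lies in the t-closure of [M], which is [M]. *)
Lemma t_max_prime M : t_max R M -> prime_ideal R M.
Proof.
move=> tM; have [tiM [pM maxM]] := tM; have [HM [M0 Mt]] := (t_idealE M).1 tiM.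
split=> //; split=> // x y Rx Ry Mxy; apply: contrapT => /not_orP [nMx nMy].
pose A z := exists m r, M m /\ R r /\ z = m + r * x.
have MA : subset M A.
  move=> m Mm; exists m, 0; split=> //; split; first exact: subr_0.
  by rewrite mul0r addr0.
have HA : ideal R A.
  split; last by move=> _ [m [r [/HM.2 Rm [Rr ->]]]]; apply: subr_D => //; apply: subr_M.
  split; first by apply/MA/(submod_0 HM.1).
  split=> [_ _ [m [r [Mm [Rr ->]]]] [m' [r' [Mm' [Rr' ->]]]]|t _ Rt [m [r [Mm [Rr ->]]]]].
    exists (m + m'), (r + r'); split; first exact: (submod_D HM.1).
    by split; [exact: subr_D|ring].
  exists (t * m), (t * r); split; first exact: (submod_Z HM.1).
  by split; [exact: subr_M|ring].
have A0 : nonzero A by case: M0 => m [Mm m0]; exists m; split=> //; apply: MA.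
have tA := t_ideal_tcl HA A0.
have A1 : tcl A 1.
  apply: contrapT => nA1; apply: nMx.
  apply/(maxM _ tA nA1) => [|/=]; first by move=> m Mm; apply/sub_tcl/MA.
  apply: sub_tcl; exists 0, 1; split; first exact: submod_0 HM.1.
  by rewrite mul1r add0r; split=> //; apply: subr_1.
apply/nMy/Mt; rewrite -[y]mulr1; apply: tcl_scale A1 => _ [m [r [Mm [Rr ->]]]].
have -> : y * (m + r * x) = y * m + r * (x * y) by ring.
by apply: (submod_D HM.1); apply: (submod_Z HM.1).
Qed.

End TClosure.

(** * Localization at t-maximal ideals and the w-closure *)

Section Localization.
Local Open Scope ring_scope.
Variables (K : fieldType) (R : K -> Prop).
Hypotheses (HR : subring R) (HQ : quotient_field R).
Implicit Types (A B C I J E M N P : K -> Prop).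

Definition cpl M : K -> Prop := fun s => R s /\ ~ M s.

(* [ext M I] is the localization [I R_M]. *)
Definition ext M I : K -> Prop := fun x => exists s, cpl M s /\ I (s * x).

Section AtPrime.
Variable M : K -> Prop.
Hypothesis HM : prime_ideal R M.

Lemma prime_0 : M 0. Proof. by case: HM => -[/submod_0]. Qed.
Lemma prime_sub x : M x -> R x. Proof. by case: HM => -[_ MR _ /MR]. Qed.
Lemma prime_D x y : M x -> M y -> M (x + y).
Proof. by case: HM => -[/submod_D MD _ _]; apply: MD. Qed.
Lemma prime_Z r x : R r -> M x -> M (r * x).
Proof. by case: HM => -[/submod_Z MZ _ _]; apply: MZ. Qed.

Lemma cpl_neq0 s : cpl M s -> s != 0.
Proof. by case=> _ nMs; apply/eqP => s0; apply: nMs; rewrite s0; apply: prime_0. Qed.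

Lemma cpl1 : cpl M 1.
Proof. by split; [exact: subr_1|case: HM => _ []]. Qed.

Lemma cplM s t : cpl M s -> cpl M t -> cpl M (s * t).
Proof.
move=> [Rs nMs] [Rt nMt]; split; first exact: subr_M.
by case: HM => _ [_ /(_ s t Rs Rt) Mst] /Mst [].
Qed.

Lemma sub_ext I : subset I (ext M I).
Proof. by move=> x Ix; exists 1; split; [exact: cpl1|rewrite mul1r]. Qed.

Lemma ext_mono I J : subset I J -> subset (ext M I) (ext M J).
Proof. by move=> IJ x [s [Ms /IJ Jx]]; exists s. Qed.

Lemma ext_div I s x : cpl M s -> ext M I (s * x) -> ext M I x.
Proof.
move=> Ms [t [Mt Ix]]; exists (t * s); split; first exact: cplM.
by rewrite -mulrA.
Qed.

Lemma ext_mul I J L x y : (forall a b, I a -> J b -> L (a * b)) ->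
  ext M I x -> ext M J y -> ext M L (x * y).
Proof.
move=> IJ [s [Ms Ix]] [t [Mt Jy]]; exists (s * t); split; first exact: cplM.
by rewrite mulrACA; apply: IJ.
Qed.

Lemma ext_submodule I : submodule R I -> submodule R (ext M I).
Proof.
move=> HI; split; first by apply: sub_ext; exact: submod_0 HI.
split=> [x y [s [Ms Ix]] [t [Mt Iy]]|r x Rr [s [Ms Ix]]]; last first.
  by exists s; split=> //; rewrite mulrCA; apply: (submod_Z HI).
exists (s * t); split; first exact: cplM.
have -> : s * t * (x + y) = t * (s * x) + s * (t * y) by ring.
by apply: (submod_D HI); apply: (submod_Z HI); case: Ms; case: Mt.
Qed.

Lemma ext_mod I x y : submodule R I -> ext M R x -> ext M I y -> ext M I (x * y).
Proof. by move=> HI; apply: ext_mul => a b; exact: (submod_Z HI). Qed.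

Lemma ext_subring : subring (ext M R).
Proof.
have HE := ext_submodule (subring_submodule HR).
split; first exact: submod_0 HE.
split; first by apply: sub_ext; exact: subr_1.
split=> x y; first exact: (submod_B HR HE).
by apply: ext_mod; apply: subring_submodule.
Qed.

Lemma ext_inv s : cpl M s -> ext M R s^-1.
Proof.
move=> Ms; exists s; split=> //.
by rewrite divff; [exact: subr_1|exact: cpl_neq0].
Qed.

Lemma locE x : loc R M x <-> ext M R x.
Proof.
split=> [[a [s [Ra [Rs [nMs ->]]]]]|[s [Ms Rx]]].
  exists s; split=> //; rewrite mulrC divfK //.
  exact: (@cpl_neq0 s).
exists (s * x), s; split=> //; case: (Ms) => Rs nMs; do 2!split=> //.
by rewrite mulrAC divff ?mul1r //; apply: cpl_neq0.
Qed.

Lemma prod_locE I x : submodule R I -> (prod I (loc R M) x <-> ext M I x).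
Proof.
move=> HI; have HE := ext_submodule HI; split=> [|[s [Ms Ix]]].
  apply: prod_sub; first exact: submod_0 HE.
    exact: submod_D HE.
  by move=> a b Ia /locE Mb; rewrite mulrC; apply: ext_mod => //; apply: sub_ext.
have -> : x = s * x * s^-1 by rewrite mulrAC divff ?mul1r //; apply: cpl_neq0.
by apply: prod_mul => //; apply/locE/ext_inv.
Qed.

(** If all products [a * b] were in [M], so would be their sums. This extracts from w-stability or
    t-invertibility at [M] a single [a] with a local inverse [b]. *)
Lemma prod_cpl A B s : (forall a b, A a -> B b -> R (a * b)) ->
  prod A B s -> ~ M s -> exists a b, A a /\ B b /\ cpl M (a * b).
Proof.
move=> AB ABs nMs; apply: contrapT => nAB; apply: nMs.
apply: prod_sub ABs; [exact: prime_0|exact: prime_D|move=> a b Aa Bb].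
by apply: contrapT => nM; apply: nAB; exists a, b; split=> //; split=> //; split=> //; apply: AB.
Qed.

End AtPrime.

Definition wcl E : K -> Prop := fun x => forall M, t_max R M -> ext M E x.

Lemma wclosE I x : submodule R I -> (wclos R I x <-> wcl I x).
Proof.
by move=> HI; split=> wx M tM; apply/(prod_locE (t_max_prime HR tM) _ HI); apply: wx.
Qed.

Lemma sub_wcl I : subset I (wcl I).
Proof. by move=> x Ix M /(t_max_prime HR) HM; apply: sub_ext. Qed.

Lemma wcl_mono I J : subset I J -> subset (wcl I) (wcl J).
Proof. by move=> IJ x wx M tM; apply: ext_mono (wx M tM). Qed.

Lemma wcl_submodule I : submodule R I -> submodule R (wcl I).
Proof.
move=> HI.
have HE M : t_max R M -> submodule R (ext M I).
  by move=> /(t_max_prime HR) HM; apply: ext_submodule.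
split; first by move=> M /HE/submod_0.
by split=> [x y wx wy M tM|r x Rr wx M tM];
  [apply: (submod_D (HE M tM))|apply: (submod_Z (HE M tM))];
  auto.
Qed.

Lemma wcl_ext M I : t_max R M -> subset (ext M (wcl I)) (ext M I).
Proof.
move=> tM x [s [Ms wx]]; apply: ext_div Ms _; first exact: t_max_prime.
exact: wx.
Qed.

Lemma wcl_idem I : subset (wcl (wcl I)) (wcl I).
Proof. by move=> x wx M tM; apply: wcl_ext (wx M tM). Qed.

Lemma w_idealE I : frac_ideal R I -> (w_ideal R I <-> subset (wcl I) I).
Proof.
move=> HI; split=> [[_ wI] x wx|wI]; first by apply/wI/wclosE => //; case: HI.
split=> // x; split=> [Ix|/wclosE wx]; first by apply/wclosE/sub_wcl=> //; case: HI.
by apply/wI/wx; case: HI.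
Qed.

(** The denominators [D] of [x] with respect to [A] form an ideal contained in no t-maximal ideal,
    so [1] is in the t-closure of [D]; multiply by [x]. *)
Lemma wcl_sub_tcl A : submodule R A -> nonzero A -> subset (wcl A) (tcl R A).
Proof.
move=> HA [c [Ac c0]] x wx.
have [a [b [Ra [Rb [b0 bx]]]]] := nonzero_fraction HR HQ x.
have [a' [b' [Ra' [Rb' [b'0 bc]]]]] := nonzero_fraction HR HQ c.
pose D r := R r /\ A (r * x).
have HD : ideal R D.
  split; last by move=> r [].
  split; first by split; [exact: subr_0|rewrite mul0r; exact: submod_0 HA].
  split=> [r s [Rr Ar] [Rs As]|r s Rr [Rs As]]; split.
  - exact: subr_D.
  - by rewrite mulrDl; apply: (submod_D HA).
  - exact: subr_M.
  - by rewrite -mulrA; apply: (submod_Z HA).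
have D0 : nonzero D.
  (* Since [b x = a] and [b' c = a'], the element [b a' x = a b' c] lies in [A]. *)
  exists (b * a'); split; last first.
    by rewrite mulf_neq0 // -bc mulf_neq0.
  split; first exact: subr_M.
  have -> : b * a' * x = a * b' * c by rewrite -bc -bx; ring.
  by apply: (submod_Z HA) => //; apply: subr_M.
have D1 : tcl R D 1.
  apply: t_max_covers => // M tM; have [s [[Rs nMs] As]] := wx M tM.
  by exists s.
rewrite -[x]mulr1; apply: tcl_scale D1 => r [_].
by rewrite mulrC.
Qed.

(** [R] is its own t-closure. Membership in [R] can therefore be tested in each [R_M]. *)
Lemma wcl_ring : subset (wcl R) R.
Proof.
have R0 : nonzero R by exists 1; split; [exact: subr_1|exact: oner_neq0].
move=> x /(wcl_sub_tcl (subring_submodule HR) R0).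
exact: tcl_sub_ring.
Qed.

Lemma t_ideal_wcl I : t_ideal R I -> subset (wcl I) I.
Proof.
by move=> /t_idealE-/(_ HR) [[HI _] [I0 It]] x /(wcl_sub_tcl HI I0)/It.
Qed.

Lemma ideal_frac I : ideal R I -> nonzero I -> frac_ideal R I.
Proof.
move=> [HI IR] I0; do 2!split=> //; exists 1; split; first exact: subr_1.
by split=> [|x Ix]; [exact: oner_neq0|rewrite mul1r; apply: IR].
Qed.

Lemma t_ideal_w_ideal I : t_ideal R I -> w_ideal R I.
Proof.
move=> tI; have [HI [I0 _]] := tI; apply/w_idealE; first exact: ideal_frac.
exact: t_ideal_wcl.
Qed.

Lemma Eend_subring I : submodule R I -> subring (Eend I).
Proof.
move=> HI; have HE := colon_submodule I HI.
split; first exact: submod_0 HE.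
split; first by move=> b Ib; rewrite mul1r.
split=> x y Ex Ey; first exact: (submod_B HR HE).
by move=> b Ib; rewrite -mulrA; apply/Ex/Ey.
Qed.

(** The w-closure of [I (E(I) : I)] is stable under [E(I)], and it is contained in [E(I)] because
    [I] is w-closed; so only [1] has to be tested. *)
Lemma w_stableE I : w_ideal R I ->
  (w_stable_ideal R I <-> wcl (prod I (colon (Eend I) I)) 1).
Proof.
move=> wI; have [[HI _] _] := wI; have sI := (w_idealE wI.1).1 wI.
have HE := colon_submodule I HI.
have HP := prod_submodule (colon (Eend I) I) HI.
have [_ [E1 [_ _]]] := Eend_subring HI.
split=> [[_ /(_ 1)[_ /(_ E1)/wclosE]]|w1]; first exact.
split=> // z; split=> [/wclosE-/(_ HP) wz i Ii|Ez].
  apply: sI => M tM; have HM := t_max_prime HR tM.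
  apply: (ext_mul HM _ (wz M tM) (sub_ext HM Ii)) => p b Pp; move: p Pp b {wz}.
  apply: prod_sub.
  - by move=> b _; rewrite mul0r; apply: submod_0 HI.
  - by move=> x y Ix Iy b Ib; rewrite mulrDl; apply: (submod_D HI); auto.
  - by move=> a y Ia Ey b Ib; rewrite (mulrC a y); apply: Ey.
apply/wclosE => // M tM; have HM := t_max_prime HR tM.
rewrite -[z]mulr1; apply: (ext_mul HM _ (sub_ext HM Ez) (w1 M tM)) => e p Ee.
move: p; apply: prod_sub => [|x y|a y Ia Ey].
- by rewrite mulr0; apply: submod_0 HP.
- by rewrite mulrDr; exact: (submod_D HP).
- by rewrite mulrA; apply: prod_mul => //; apply: Ee.
Qed.

(** The ideal [I (R : I)] has t-closure [R] exactly when no t-maximal ideal contains it. The local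
    condition says that [a] generates [I R_M]. *)
Lemma t_invertibleE I : frac_ideal R I ->
  (t_invertible R I <->
   forall M, t_max R M -> exists a b, I a /\ colon R I b /\ cpl M (a * b)).
Proof.
move=> [HI [[i [Ii i0]] [d [_ [d0 dI]]]]].
have cd : colon R I d by move=> b /dI.
have IcR a b : I a -> colon R I b -> R (a * b) by move=> Ia Ib; rewrite mulrC; apply: Ib.
have HP := prod_submodule (colon R I) HI.
have P0 : nonzero (prod I (colon R I)).
  by exists (i * d); split; [exact: prod_mul|rewrite mulf_neq0].
have PR : subset (prod I (colon R I)) R.
  by apply: prod_sub => //; [exact: subr_0|exact: subr_D].
split=> [I1 M tM|Icov x].
  have HM := t_max_prime HR tM.
  have {}I1 : tcl R (prod I (colon R I)) 1.
    by apply/(tclosE HR HP P0)/I1; exact: subr_1.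
  apply: contrapT => nI; apply: (t_max_no_unit HR tM _ I1) => p Pp.
  by apply: contrapT => nMp; apply/nI/(prod_cpl HM IcR Pp).
split=> [/(tclosE HR HP P0)|Rx]; first exact: tcl_sub_ring.
apply/(tclosE HR HP P0); rewrite -[x]mulr1; apply: (submod_Z (tcl_submodule HR _)) => //.
apply: t_max_covers => // M tM; have [a [b [Ia [Ib [_ nM]]]]] := Icov M tM.
by exists (a * b); split=> //; apply: prod_mul.
Qed.

End Localization.

(** * PvMDs: integral closure, localization of t-closures, idempotent t-primes *)

Section PvMD.
Local Open Scope ring_scope.
Variables (K : fieldType) (R : K -> Prop).
Hypotheses (HR : subring R) (HQ : quotient_field R).
Implicit Types (A B C I J E M N P : K -> Prop).

Lemma integrally_closed_PvMD : integrally_closed R -> w_stable R -> PvMD R.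
Proof.
move=> intR stR M tM x x0; have HM := t_max_prime HR tM.
have [a [b [Ra [Rb [b0 bx]]]]] := nonzero_fraction HR HQ x.
have a0 : a != 0 by rewrite -bx mulf_neq0.
pose J z := exists p q, R p /\ R q /\ z = p * a + q * b.
have JR : subset J R.
  by move=> _ [p [q [Rp [Rq ->]]]]; apply: (subr_D HR); apply: (subr_M HR).
have HJ : submodule R J.
  split; first by exists 0, 0; rewrite !mul0r addr0; split; [|split] => //; apply: subr_0.
  split=> [_ _ [p [q [Rp [Rq ->]]]] [p' [q' [Rp' [Rq' ->]]]]|r _ Rr [p [q [Rp [Rq ->]]]]].
    exists (p + p'), (q + q'); split; first exact: subr_D.
    by split; [exact: subr_D|ring].
  exists (r * p), (r * q); split; first exact: subr_M.
  by split; [exact: subr_M|ring].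
have Ja : J a.
  exists 1, 0; rewrite mul1r mul0r addr0.
  by split; [exact: subr_1|split=> //; exact: subr_0].
have Jb : J b.
  exists 0, 1; rewrite mul1r mul0r add0r.
  by split; [exact: subr_0|split=> //; exact: subr_1].
pose I := wcl R J.
have HI : submodule R I by apply: wcl_submodule.
have IR : subset I R by move=> z /(wcl_mono JR)/(wcl_ring HR HQ).
have wI : w_ideal R I.
  apply/(w_idealE HR); last exact: wcl_idem.
  apply: ideal_frac => //; exists b; split=> //.
  exact: sub_wcl.
(* The 2 x 2 determinant trick, on the generators [a] and [b]. *)
have EI : subset (Eend I) R.
  move=> z Ez; apply: (wcl_ring HR HQ) => N tN; have HN := t_max_prime HR tN.
  have [s1 [Ns1 [p [q [Rp [Rq Ep]]]]]] := Ez _ (sub_wcl HR Ja) N tN.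
  have [s2 [Ns2 [r [u [Rr [Ru Er]]]]]] := Ez _ (sub_wcl HR Jb) N tN.
  have [[Rs1 _] [Rs2 _]] := (Ns1, Ns2).
  exists (s1 * s2); split; first exact: cplM.
  (* [t] and [d] are the trace and determinant of the matrix with rows [(s2 p, s2 q)] and
     [(s1 r, s1 u)], which expresses [w a] and [w b] through [a] and [b]. *)
  set w := _ * z; pose t := s2 * p + s1 * u; pose d := s1 * s2 * (p * u - q * r).
  apply: intR; exists (Poly [:: d; - t; 1]); split; last split.
  - by rewrite monicE lead_coefE (@PolyK _ 0) //= oner_neq0.
  - move=> i; rewrite coef_Poly; case: i => [|[|[|i]]] /=.
    + by apply: (subr_M HR); [exact: subr_M|apply: (subr_B HR); exact: subr_M].
    + by apply: (subr_N HR); apply: (subr_D HR); exact: subr_M.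
    + exact: subr_1.
    + by rewrite nth_nil; apply: subr_0.
  - rewrite /root horner_Poly /= mul0r add0r mul1r.
    suff : (w - s2 * p) * (w - s1 * u) = s1 * s2 * (q * r).
      by move=> Ew; apply/eqP; rewrite -[RHS](subrr (s1 * s2 * (q * r))) -{1}Ew /d /t; ring.
    apply: (mulIf (mulf_neq0 a0 b0)).
    have Ea : (w - s2 * p) * a = s2 * (q * b).
      have -> : q * b = s1 * (z * a) - p * a by rewrite Ep; ring.
      by rewrite /w; ring.
    have Eb : (w - s1 * u) * b = s1 * (r * a).
      have -> : r * a = s2 * (z * b) - u * b by rewrite Er; ring.
      by rewrite /w; ring.
    by rewrite mulrACA Ea Eb; ring.
have [s [[_ nMs] Ps]] := (w_stableE HR wI).1 (stR I wI) M tM.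
rewrite mulr1 in Ps.
have IyR y c : colon (Eend I) I y -> I c -> R (c * y).
  by move=> Iy Ic; rewrite mulrC; apply/EI/Iy.
have [c [y [Ic [Iy [_ nMcy]]]]] := prod_cpl HM (fun c y Ic Iy => IyR y c Iy Ic) Ps nMs.
have [t [Mt [p [q [Rp [Rq Ec]]]]]] := Ic M tM.
have nMt : ~ M (t * c * y).
  by rewrite -mulrA => Mtcy; case: (cplM HR HM Mt (conj (IyR _ _ Iy Ic) nMcy)).
have Ray : R (a * y) by apply: IyR => //; apply: sub_wcl.
have Rby : R (b * y) by apply: IyR => //; apply: sub_wcl.
(* As [t c y = p a y + q b y] is outside [M], one of [a y] and [b y] is a unit of [R_M]; their
   quotient is [x]. *)
have [Mby|nMby] := EM (M (b * y)); last first.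
  left; apply/locE => //; exists (b * y); split=> //.
  by rewrite mulrAC bx.
right; apply/locE => //; exists (a * y); split.
  split=> // May; apply: nMt; rewrite Ec mulrDl -!mulrA.
  by apply: (prime_D HM); apply: (prime_Z HM).
by have -> : a * y * x^-1 = b * y by rewrite -bx; field.
Qed.

Section Valuation.
Hypothesis VR : PvMD R.
Variable M : K -> Prop.
Hypothesis tM : t_max R M.
Let HM := t_max_prime HR tM.

(** The second case says that the inverse of [x] lies in [M R_M]. Asking for [M r] rather than [R r]
    makes the cases exclusive. *)
Lemma PvMD_cases x : ext R M R x \/ exists s r, cpl R M s /\ M r /\ s = r * x.
Proof.
have [->|x0] := eqVneq x 0.
  by left; apply: sub_ext => //; apply: subr_0.
case: (VR tM x0) => /(locE HM); first by left.
case=> s [Ms Rsx]; have [Mr|nMr] := EM (M (s * x^-1)).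
  by right; exists s, (s * x^-1); rewrite divfK.
left; exists (s * x^-1); split=> //; rewrite divfK //; by case: Ms.
Qed.

Lemma PvMD_compare x y : (exists s r, cpl R M s /\ R r /\ s * x = r * y) \/
  exists s r, cpl R M s /\ M r /\ s * y = r * x.
Proof.
have [->|y0] := eqVneq y 0.
  right; exists 1, 0; rewrite mul0r mulr0; split; first exact: cpl1.
  by split=> //; apply: prime_0 HM.
have [[s [Ms Rsx]]|[s [r [Ms [Mr Es]]]]] := PvMD_cases (x / y).
  by left; exists s, (s * (x / y)); rewrite -!mulrA mulVf ?mulr1.
by right; exists s, r; split=> //; split=> //; rewrite Es -!mulrA mulVf ?mulr1.
Qed.

(* Over the valuation ring [R_M] finitely generated ideals are principal, hence
   divisorial. *)
Lemma tcl_ext A : submodule R A -> nonzero A -> subset (tcl R A) (ext R M A).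
Proof.
move=> HA [c [Ac c0]] x [s [sA sx]].
have [t [j [Mt [Aj [j0 sj]]]]] : exists t j, cpl R M t /\ A j /\ j != 0 /\
    forall a, a \in s -> exists r, R r /\ t * a = r * j.
  elim: s sA {sx} => [_|a s IH sA].
    by exists 1, c; split; first exact: cpl1.
  have [|t [j [Mt [Aj [j0 sj]]]]] := IH.
    by move=> b bs; apply: sA; rewrite inE bs orbT.
  have Rt : R t by case: Mt.
  have [[u [r [Mu [Rr Eu]]]]|[u [r [Mu [/(prime_sub HM) Rr Eu]]]]] := PvMD_compare a j.
    have Ru : R u by case: Mu.
    exists (t * u), j; split; first exact: cplM.
    do 2!split=> //; move=> b; rewrite inE => /orP[/eqP->|/sj [r' [Rr' Er']]].
      by exists (t * r); rewrite -!mulrA Eu; split=> //; apply: subr_M.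
    exists (u * r'); split; first exact: subr_M.
      by rewrite mulrAC Er'; ring.
  have Ru : R u by case: Mu.
  exists (t * u), a; split; first exact: cplM.
  split; first by apply: sA; rewrite mem_head.
  split.
    apply: contraTneq (mulf_neq0 (cpl_neq0 HM Mu) j0) => a0.
    by rewrite Eu a0 mulr0 eqxx.
  move=> b; rewrite inE => /orP[/eqP->|/sj [r' [Rr' Er']]].
    by exists (t * u); split=> //; apply: subr_M.
  exists (r' * r); split; first exact: subr_M.
  by rewrite mulrAC Er' -(mulrA r' r) -Eu; ring.
(* The multiplier [t / j] sends [s] into [R], hence also [x]: thus [t x] lies in [j R]. *)
have /sx Rx : forall a, a \in s -> R (t / j * a).
  by move=> a /sj [r [Rr Er]]; rewrite mulrAC Er mulfK.
exists t; split=> //.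
have -> : t * x = x * (t / j) * j by field.
exact: (submod_Z HA).
Qed.

(** By [tcl_ext] the t-closure of [P] is contained in [P R_M], which meets [R] in [P]. *)
Lemma sub_t_max_t_prime P : prime_ideal R P -> nonzero P -> subset P M -> t_prime R P.
Proof.
move=> HP P0 PM; split=> //; apply/(t_idealE HR); split; first by case: HP.
split=> // x Px.
have Rx : R x by apply: tcl_sub_ring Px; case: HP => -[].
have [s [[Rs nMs] Psx]] := tcl_ext (HP.1.1) P0 Px.
by case: (HP.2.2 s x Rs Rx Psx) => // /PM.
Qed.

End Valuation.

(** If [x] is not in [R_M], write [s = r x] with [r] in [M] and [s] outside. Multiplying the monic
    equation of degree [n] by [r ^+ n] puts [s ^+ n] in [M]. *)
Lemma PvMD_integrally_closed : PvMD R -> integrally_closed R.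
Proof.
move=> VR x [p [pmon [Rp rx]]]; apply: (wcl_ring HR HQ) => M tM.
have HM := t_max_prime HR tM.
have [//|[s [r [Ms [Mr Es]]]]] := PvMD_cases VR tM x; exfalso.
have Ru n : cpl R M (s ^+ n).
  by elim: n => [|n IH]; rewrite ?exprS; [exact: cpl1|exact: cplM].
have Mu n : M (r ^+ n.+1).
  elim: n => [//|n IH]; rewrite exprS; apply: (prime_Z HM) => //.
  exact: prime_sub Mr.
move: rx; rewrite /root horner_coef.
have : p`_(size p).-1 = 1 by move: pmon; rewrite monicE lead_coefE => /eqP.
case Esz: (size p) => [|n] /= Ep.
  by move: (monic_neq0 pmon); rewrite -size_poly_eq0 Esz.
rewrite big_ord_recr /= Ep mul1r addr_eq0 -eqr_oppLR => /eqP Ex.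
case: (Ru n) => _; apply; rewrite Es exprMn -Ex mulrN.
(* The exponent [n - i] is written as a successor because [Mu] needs a positive power. *)
have -> : - (r ^+ n * \sum_(i < n) p`_i * x ^+ i) =
    \sum_(i < n) - p`_i * s ^+ i * r ^+ (n - i.+1).+1.
  rewrite -mulrN -sumrN mulr_sumr; apply: eq_bigr => i _.
  rewrite Es exprMn -subSn // subSS.
  have -> : r ^+ n = r ^+ i * r ^+ (n - i) by rewrite -exprD subnKC // ltnW.
  ring.
apply: (big_ind M); [exact: prime_0 HM|exact: prime_D HM|move=> i _].
apply: (prime_Z HM) => //; apply: (subr_M HR); first by apply: (subr_N HR).
by case: (Ru i).
Qed.

(** At [N] not containing [M], an element of [M] outside [N] is a denominator for [z]. At [N = M],
    failure would give [s = r z] with [r] in [M] and [s] outside, contradicting that [z] sends [M]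
    into [M]. *)
Lemma t_max_colon M : PvMD R -> t_max R M -> subset (Eend M) R.
Proof.
move=> VR tM z Ez; have HM := t_max_prime HR tM; apply: (wcl_ring HR HQ) => N tN.
have HN := t_max_prime HR tN.
have [[m [Mm nNm]]|MN] := EM (exists m, M m /\ ~ N m).
  have Rm := prime_sub HM Mm; exists m; split=> //.
  by rewrite mulrC; apply/(prime_sub HM)/Ez.
have {}MN : subset M N.
  by move=> m Mm; apply: contrapT => nNm; apply: MN; exists m.
have [[tiN [pN _]] [_ [_ maxM]]] := (tN, tM).
have {}MN := maxM N tiN pN MN.
have [//|[s [r [[Rs nNs] [/MN Mr Es]]]]] := PvMD_cases VR tN z.
by case: nNs; apply/MN; rewrite Es mulrC; apply: Ez.
Qed.

(** As [E(M) = R], the colon in the definition of w-stability is [(R : M)]. *)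
Lemma w_stable_PvMD_t_invertible : w_stable R -> PvMD R ->
  forall M, t_max R M -> t_invertible R M.
Proof.
move=> stR VR M tM; have HM := t_max_prime HR tM; have [tiM _] := tM.
have wM := t_ideal_w_ideal HR HQ tiM.
apply/(t_invertibleE HR wM.1) => N tN; have HN := t_max_prime HR tN.
have [s [[_ nNs] Ps]] := (w_stableE HR wM).1 (stR M wM) N tN.
rewrite mulr1 in Ps.
have EM := t_max_colon VR tM.
have [|a [y [Ma [Ey Nay]]]] := prod_cpl HN _ Ps nNs.
  by move=> a y Ma Ey; rewrite mulrC; apply/EM/Ey.
by exists a, y; split=> //; split=> // b /Ey /EM.
Qed.

Lemma strongly_discreteE : strongly_discrete R <->
  PvMD R /\ forall P, t_prime R P -> ~ subset P (tcl R (prod P P)).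
Proof.
split=> -[VR sd]; split=> // P tP PP; apply: (sd P tP) => x;
  have [HP tiP] := tP; have [[HsP PR] [[p [Pp p0]] Pt]] := (t_idealE HR P).1 tiP;
  have P0 : nonzero (prod P P) by [exists (p * p); split; [exact: prod_mul|rewrite mulf_neq0]];
  have HPP := prod_submodule P HsP.
  split=> [/(tclosE HR HPP P0) tx|/PP/(tclosE HR HPP P0)//].
  apply/Pt/(tcl_mono _ tx); apply: prod_sub; [exact: submod_0 HsP|exact: submod_D HsP|].
  by move=> a b /PR Ra Pb; apply: (submod_Z HsP).
by move=> Px; apply/(tclosE HR HPP P0)/PP.
Qed.

Lemma w_stable_prime_not_idempotent P : PvMD R -> t_prime R P ->
  w_stable_ideal R P -> ~ subset P (tcl R (prod P P)).
Proof.
move=> VR [HP tiP] stP PP; have [[HsP PR] [[p [Pp p0]] _]] := tiP.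
have [M [tM PM]] := t_max_exists HR tiP HP.2.1; have HM := t_max_prime HR tM.
have P0 : nonzero (prod P P) by exists (p * p); split; [exact: prod_mul|rewrite mulf_neq0].
have HPP := prod_submodule P HsP; have HE := ext_submodule HR HM HsP.
have [s [Ms Ps]] := (w_stableE HR stP.1).1 stP M tM.
rewrite mulr1 in Ps.
suff [u [Mu /PM Mus]] : ext R M P s by case: (cplM HR HM Mu Ms).
apply: prod_sub Ps; [exact: submod_0 HE|exact: submod_D HE|move=> a y Pa Ey].
have [u [Mu Pu]] := tcl_ext VR tM HPP P0 (PP _ Pa).
exists u; split=> //; rewrite mulrA; move: Pu; move: (u * a) => z {u Mu a Pa}.
apply: (prod_sub (C := fun z => P (z * y))) => [|v w|q r Pq Pr].
- by rewrite mul0r; apply: submod_0 HsP.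
- by rewrite mulrDl; apply: (submod_D HsP).
- by have -> : q * r * y = y * r * q by [ring]; apply: Ey.
Qed.

End PvMD.

(* A local domain [D] with principal maximal ideal [pi D] all of whose ideals are
   stable is a valuation domain.  With [T = D[1/pi]] and [P] the intersection of the
   [pi^n D], suppose [a] and [b] are incomparable over [T] and put
   [L = a T + b T].  Stability of the ideals [u T + v D] yields, for each line
   [u T + P L] of [L / P L], a multiplication [q] mapping [L] into that line but
   not into [P L].  Since multiplications commute, the one attached to the line of
   [a] kills all other lines modulo [P L]; these span [L], a contradiction. *)
Section LocalStable.
Local Open Scope ring_scope.
Variables (K : fieldType) (D : K -> Prop) (pi : K).
Hypotheses (HD : subring D) (HQ : quotient_field D).
Hypotheses (Dpi : D pi) (pi0 : pi != 0) (pi_nonunit : ~ D pi^-1).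
Hypothesis D_local : forall d, D d -> D (d / pi) \/ (d != 0 /\ D d^-1).
Hypothesis D_stable : forall I, submodule D I -> nonzero I -> subset I D ->
  prod I (colon (Eend I) I) 1.

Let T : K -> Prop := fun t => exists n, D (pi ^+ n * t).
Let P : K -> Prop := fun p => forall n, D (p / pi ^+ n).

Let piX0 n : pi ^+ n != 0. Proof. exact: expf_neq0. Qed.

Let D_piX n : D (pi ^+ n).
Proof. by elim: n => [|n IH]; rewrite ?exprS; [exact: subr_1|exact: subr_M]. Qed.

Let sub_DT d : D d -> T d.
Proof. by move=> Dd; exists 0%N; rewrite mul1r. Qed.

Let sub_PD p : P p -> D p.
Proof. by move/(_ 0%N); rewrite divr1. Qed.

Let T_piV n : T (pi ^- n).
Proof. by exists n; rewrite divff //; apply: subr_1. Qed.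

Let T_M x y : T x -> T y -> T (x * y).
Proof.
move=> [n Dx] [m Dy]; exists (n + m)%N.
by rewrite exprD mulrACA; apply: subr_M.
Qed.

Let T_B x y : T x -> T y -> T (x - y).
Proof.
move=> [n Dx] [m Dy]; exists (n + m)%N.
have -> : pi ^+ (n + m) * (x - y) = pi ^+ m * (pi ^+ n * x) - pi ^+ n * (pi ^+ m * y).
  by rewrite exprD; ring.
by apply: (subr_B HD); apply: subr_M.
Qed.

Let HT : subring T.
Proof.
split; first by apply: sub_DT; exact: subr_0.
by split; [apply: sub_DT; exact: subr_1|split].
Qed.

Let P_module : submodule T P.
Proof.
split; first by move=> n; rewrite mul0r; apply: subr_0.
split=> [x y Px Py n|t p [n Dt] Pp m]; first by rewrite mulrDl; apply: subr_D.
have -> : t * p / pi ^+ m = (pi ^+ n * t) * (p / pi ^+ (n + m)).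
  by rewrite exprD; field; rewrite !piX0.
exact: subr_M.
Qed.

Let P_D := submod_D P_module.
Let P_Z := submod_Z P_module.
Let P_B := submod_B HT P_module.

(** The exponent [k] is the last one for which [pi ^+ k] divides [d]; the quotient is then not
    divisible by [pi], hence a unit. *)
Let D_factor d : D d -> P d \/ exists k e, d = e * pi ^+ k /\ D e /\ e != 0 /\ D e^-1.
Proof.
move=> Dd; have [Pd|/existsNP [n nDn]] := EM (P d); first by left.
right; elim: n nDn => [|n IH nDn]; first by rewrite divr1.
have [Dn|/IH//] := EM (D (d / pi ^+ n)).
have [Dpi'|[e0 De]] := D_local Dn.
  by case: nDn; rewrite exprSr invfM mulrA.
by exists n, (d / pi ^+ n); rewrite divfK.
Qed.

(** By [D_factor], since [pi] is invertible in [T]. So [T] is local with maximal ideal [P]. *)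
Let T_cases t : T t -> P t \/ (t != 0 /\ T t^-1).
Proof.
move=> [n /D_factor [Pt|[k [e [Et [De [e0 Dei]]]]]]].
  left; have -> : t = pi ^- n * (pi ^+ n * t) by rewrite mulrA mulVf ?mul1r.
  exact: P_Z.
right; have {Et} -> : t = pi ^- n * (e * pi ^+ k) by rewrite -Et mulrA mulVf ?mul1r.
split; first by rewrite !mulf_neq0 ?invr_neq0.
rewrite !invfM invrK; apply: T_M; first exact: sub_DT.
by apply: T_M => //; apply: sub_DT.
Qed.

Let unit_sub_pi e d : D e -> D e^-1 -> e != 0 -> D d -> D (d / pi) ->
  e - d != 0 /\ T (e - d)^-1.
Proof.
move=> De Dei e0 Dd Ddpi; have Ded : D (e - d) by apply: subr_B.
have [Dpi'|[ed0 Dedi]] := D_local Ded; last by split=> //; apply: sub_DT.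
case: pi_nonunit; have -> : pi^-1 = e^-1 * ((e - d) / pi + d / pi) by field; rewrite pi0.
by apply: subr_M => //; apply: subr_D.
Qed.

Let unit_1sub p : P p -> 1 - p != 0 /\ T (1 - p)^-1.
Proof.
move=> Pp; apply: unit_sub_pi; rewrite ?invr1 ?oner_neq0 //; try exact: subr_1.
  exact: sub_PD.
exact: (Pp 1%N).
Qed.

Let PL u v x := exists p p', P p /\ P p' /\ x = u * p + v * p'.

Let PL_module u v : submodule T (PL u v).
Proof.
have P0 := submod_0 P_module.
split; first by exists 0, 0; rewrite !mulr0 addr0.
split=> [_ _ [p [p' [Pp [Pp' ->]]]] [r [r' [Pr [Pr' ->]]]]|t _ Tt [p [p' [Pp [Pp' ->]]]]].
  by exists (p + r), (p' + r'); split; [exact: P_D|split; [exact: P_D|ring]].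
by exists (t * p), (t * p'); split; [exact: P_Z|split; [exact: P_Z|ring]].
Qed.

(** With [L = u T + v T] this is [u T + P L], the line of [u] in [L / P L]. *)
Let line u v x := exists t p, T t /\ P p /\ x = u * t + v * p.

(** Let [I = u T + v D]. For [y] in [(E(I) : I)], [q = y u] maps [I] into every [pi^n I], since all
    [u pi^-n] are in [I]; hence into the line. If every such [q] mapped [u] and [v] into [P L],
    stability would give [u = u p + v p'] with [p, p'] in [P]; as [1 - p] is a unit of [T], [u]
    would be a multiple of [v]. *)
Let line_multiplier u v : P u -> P v ->
  (forall t, T t -> u <> v * t) -> (forall t, T t -> v <> u * t) ->
  exists q, line u v (q * u) /\ line u v (q * v) /\
    ~ (PL u v (q * u) /\ PL u v (q * v)).
Proof.
move=> Pu Pv uNv vNu; apply: contrapT => noq.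
have {}noq q : line u v (q * u) -> line u v (q * v) -> PL u v (q * u) /\ PL u v (q * v).
  by move=> qu qv; apply: contrapT => nq; apply: noq; exists q.
pose I x := exists t d, T t /\ D d /\ x = u * t + v * d.
have [T0 T1 D0 D1] : [/\ T 0, T 1, D 0 & D 1].
  by split; [exact: subr_0 HT|exact: subr_1 HT|exact: subr_0|exact: subr_1].
have HI : submodule D I.
  split; first by exists 0, 0; rewrite !mulr0 addr0.
  split=> [_ _ [t [d [Tt [Dd ->]]]] [t' [d' [Tt' [Dd' ->]]]]|r _ Dr [t [d [Tt [Dd ->]]]]].
    exists (t + t'), (d + d'); split; first exact: (subr_D HT).
    by split; [exact: subr_D|ring].
  exists (r * t), (r * d); split; first by apply: T_M => //; apply: sub_DT.
  by split; [exact: subr_M|ring].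
have Iu t : T t -> I (u * t) by move=> Tt; exists t, 0; rewrite mulr0 addr0.
have Iu1 : I u by rewrite -[u]mulr1; apply: Iu.
have Iv : I v by exists 0, 1; rewrite mulr0 mulr1 add0r.
have ID : subset I D.
  move=> _ [t [d [Tt [Dd ->]]]]; rewrite mulrC; apply: subr_D => //.
    exact/sub_PD/P_Z.
  by apply: subr_M => //; apply: sub_PD.
have I0 : nonzero I.
  exists u; split=> //.
  by apply/eqP => u0; apply: (uNv 0) => //; rewrite mulr0.
have divisible y : (forall n, I (pi ^- n * y)) -> line u v y.
  move=> Iy; have := Iy 0%N; rewrite invr1 mul1r => -[t [d [Tt [Dd Ey]]]].
  have [Pd|[k [e [Ed [De [e0 Dei]]]]]] := D_factor Dd; first by exists t, d.
  (* One power of [pi] more than divides [d]: comparing the two expressions of [y] gives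
     [v pi^k (e - pi d')] in [u T], with [e - pi d'] a unit. *)
  have [t' [d' [Tt' [Dd' Ey']]]] := Iy k.+1.
  have [f0 Tf] : e - pi * d' != 0 /\ T (e - pi * d')^-1.
    apply: unit_sub_pi => //; first exact: subr_M.
    by rewrite mulrAC divff ?mul1r.
  case: (vNu ((pi ^+ k.+1 * t' - t) * (e - pi * d')^-1 * pi ^- k)).
    apply: T_M => //; apply: T_M => //; apply: T_B => //.
    by apply: T_M => //; apply: sub_DT.
  have {}Ey' : u * t + v * (e * pi ^+ k) = pi ^+ k.+1 * (u * t' + v * d').
    by rewrite -Ey' mulVKf // -Ed.
  have Ev : v * (pi ^+ k * (e - pi * d')) = u * (pi ^+ k.+1 * t' - t).
    transitivity (u * t + v * (e * pi ^+ k) - u * t - v * d' * pi ^+ k.+1).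
      by rewrite exprS; ring.
    by rewrite Ey'; ring.
  by rewrite !mulrA -Ev; field; rewrite f0 piX0.
have stab : subset (prod I (colon (Eend I) I)) (fun z => PL u v (z * u)).
  apply: prod_sub => [|x y|_ y [t [d [Tt [Dd ->]]]] Ey].
  - by rewrite mul0r; apply: submod_0 (PL_module u v).
  - by rewrite mulrDl; apply: (submod_D (PL_module u v)).
  have yuI x : I x -> line u v (y * u * x).
    move=> Ix; apply: divisible => n.
    have -> : pi ^- n * (y * u * x) = y * (u * pi ^- n) * x by ring.
    by apply: Ey => //; apply: Iu.
  have [PLu PLv] := noq _ (yuI _ Iu1) (yuI _ Iv).
  have -> : (u * t + v * d) * y * u = t * (y * u * u) + d * (y * u * v) by ring.
  by apply: (submod_D (PL_module u v)); apply: (submod_Z (PL_module u v)) => //; apply: sub_DT.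
have [p [p' [Pp [Pp' Eu]]]] := stab _ (D_stable HI I0 ID).
have [p1 Tp] := unit_1sub Pp.
case: (uNv (p' * (1 - p)^-1)); first by apply: T_M => //; apply/sub_DT/sub_PD.
apply: (mulIf p1); rewrite mulrA divfK // mulrBr mulr1 -{1}[u]mul1r Eu; ring.
Qed.

Section TwoGenerators.
Variables a b : K.
Hypotheses (Pa : P a) (Pb : P b).
Hypotheses (aNb : forall t, T t -> a <> b * t) (bNa : forall t, T t -> b <> a * t).

Let span2 x := exists t t', T t /\ T t' /\ x = a * t + b * t'.
Let into q n := forall x, span2 x ->
  exists t w, T t /\ PL a b w /\ q * x = n * t + w.

Let PL_span p x : P p -> span2 x -> PL a b (x * p).
Proof.
move=> Pp [t [t' [Tt [Tt' ->]]]]; exists (t * p), (t' * p).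
by split; [exact: P_Z|split; [exact: P_Z|ring]].
Qed.

(** Change of generators: [line_multiplier] controls [q] on [u, v], whereas [L] is given by
    [a, b]. *)
Let line_into q u v : (forall p, P p -> PL a b (v * p)) ->
  (exists s s' r r', [/\ T s, T s', T r & T r'] /\ a = u * s + v * s' /\ b = u * r + v * r') ->
  line u v (q * u) -> line u v (q * v) -> into q u.
Proof.
move=> PLv [s [s' [r [r' [[Ts Ts' Tr Tr'] [Ea Eb]]]]]].
move=> [t1 [p1 [Tt1 [Pp1 E1]]]] [t2 [p2 [Tt2 [Pp2 E2]]]] x [t [t' [Tt [Tt' ->]]]].
pose c := s * t + r * t'; pose c' := s' * t + r' * t'.
have Tc : T c by apply: (subr_D HT); apply: T_M.
have Tc' : T c' by apply: (subr_D HT); apply: T_M.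
exists (t1 * c + t2 * c'), (v * (p1 * c + p2 * c')); split.
  by apply: (subr_D HT); apply: T_M.
split; first by apply: PLv; apply: P_D; rewrite mulrC; apply: P_Z.
transitivity (q * u * c + q * v * c'); first by rewrite Ea Eb /c /c'; ring.
by rewrite E1 E2; ring.
Qed.

(** The lines of [a] and [c a + b] meet only in zero modulo [P L]: comparing coefficients gives
    [b y] in [a T] with [y] congruent to [t'], and a unit [y] would make [b] a multiple of [a]. *)
Let lines_meet c t t' w w' : T c -> T t -> T t' -> PL a b w -> PL a b w' ->
  a * t + w = (c * a + b) * t' + w' -> P t'.
Proof.
move=> Tc Tt Tt' [p [p' [Pp [Pp' ->]]]] [r [r' [Pr [Pr' ->]]]] E.
have PT x : P x -> T x by move=> /sub_PD/sub_DT.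
pose y := t' + (r' - p').
have Ty : T y by apply: (subr_D HT) => //; apply: T_B; apply: PT.
have Eby : b * y = a * (t + p - c * t' - r).
  transitivity ((c * a + b) * t' + (a * r + b * r') - a * (c * t' + r) - b * p').
    by rewrite /y; ring.
  by rewrite -E; ring.
have -> : t' = y - (r' - p') by rewrite /y; ring.
apply: P_B; last exact: P_B.
have [//|[y0 Tyi]] := T_cases Ty.
case: (bNa (t := (t + p - c * t' - r) / y)).
  apply: T_M => //; apply: T_B; last exact: PT.
  by apply: T_B; [apply: (subr_D HT) => //; exact: PT|exact: T_M].
by rewrite mulrA -Eby mulfK.
Qed.

(** The product [q q'] maps [L] into both lines, hence into [P L]. Some [q' l] is a unit multiple of
    [c a + b] modulo [P L], so [q] kills that line. *)
Let kills c q q' : T c -> into q a -> into q' (c * a + b) ->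
  ~ (PL a b (q' * a) /\ PL a b (q' * b)) -> PL a b (q * (c * a + b)).
Proof.
move=> Tc qa q'n nPL; have HPL := PL_module a b.
have [T0 T1] : T 0 /\ T 1 by split; [exact: subr_0 HT|exact: subr_1 HT].
have PT x : P x -> T x by move=> /sub_PD/sub_DT.
have La : span2 a by exists 1, 0; rewrite mulr0 mulr1 addr0.
have Lb : span2 b by exists 0, 1; rewrite mulr0 mulr1 add0r.
have Ln n t w : span2 n -> T t -> PL a b w -> span2 (n * t + w).
  move=> [s [s' [Ts [Ts' ->]]]] Tt [p [p' [Pp [Pp' ->]]]].
  exists (s * t + p), (s' * t + p').
  by split; [|split]; [..|ring]; apply: (subr_D HT); try exact: PT; apply: T_M.
have Lq x : span2 x -> span2 (q * x).
  by move=> /qa [t [w [Tt [PLw ->]]]]; apply: Ln.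
have Lc : span2 (c * a + b) by exists c, 1; rewrite mulr1 mulrC.
have [l [Ll nPLl]] : exists l, span2 l /\ ~ PL a b (q' * l).
  by move/not_andP: nPL => [nPL|nPL]; [exists a|exists b].
have [t [w [Tt [PLw El]]]] := q'n _ Ll.
have [t0 Tti] : t != 0 /\ T t^-1.
  have [Pt|//] := T_cases Tt; case: nPLl; rewrite El.
  by apply: (submod_D HPL) => //; apply: PL_span.
have [s [z [Ts [PLz Es]]]] : exists s z, T s /\ PL a b z /\ q * (q' * l) = a * s + z.
  by apply: qa; rewrite El; apply: Ln.
have [s' [z' [Ts' [PLz' Es']]]] := q'n _ (Lq _ Ll).
have Ps' : P s' by apply: (lines_meet Tc Ts Ts' PLz PLz'); rewrite -Es -Es'; ring.
have PLqq : PL a b (q * (q' * l)).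
  rewrite mulrCA Es'; apply: (submod_D HPL) => //.
  exact: PL_span.
have PLqw : PL a b (q * w).
  case: PLw => p [p' [Pp [Pp' ->]]]; rewrite mulrDr !mulrA.
  by apply: (submod_D HPL); apply: PL_span => //; apply: Lq.
have -> : q * (c * a + b) = t^-1 * (q * (q' * l) - q * w).
  have -> : q * (q' * l) - q * w = t * (q * (c * a + b)) by rewrite El; ring.
  by rewrite mulKf.
by apply: (submod_Z HPL) => //; apply: (submod_B HT HPL).
Qed.

Lemma incomparable_absurd : False.
Proof.
have HPL := PL_module a b.
have [T0 T1] : T 0 /\ T 1 by split; [exact: subr_0 HT|exact: subr_1 HT].
have P0 := submod_0 P_module.
have second c : T c -> exists q', into q' (c * a + b) /\
    ~ (PL a b (q' * a) /\ PL a b (q' * b)).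
  move=> Tc; have [||t Tt|t Tt|q' [q'u [q'v nPL]]] := @line_multiplier (c * a + b) a.
  - by apply: P_D => //; apply: P_Z.
  - exact: Pa.
  - move=> E; apply: (bNa (t := t - c)); first exact: T_B.
    by rewrite mulrBr -E; ring.
  - have [Pt|[t0 Tti]] := T_cases Tt => E.
      have [f0 Tf] := unit_1sub (P_Z Tc Pt).
      apply: (aNb (t := t / (1 - c * t))); first exact: T_M.
      by apply: (mulIf f0); rewrite mulrA divfK // mulrBr {1}E; ring.
    apply: (bNa (t := t^-1 - c)); first exact: T_B.
    by rewrite mulrBr {1}E mulfK //; ring.
  exists q'; split.
    apply: (@line_into _ _ a) => //; first by move=> p Pp; exists p, 0; rewrite mulr0 addr0.
    exists 0, 1, 1, (- c); rewrite !mulr0 !mulr1 add0r; split=> //.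
      by split=> //; apply: (subr_N HT).
    by split=> //; ring.
  move=> [PLa PLb]; apply: nPL; split; last first.
    case: PLa => p [p' [Pp [Pp' ->]]]; exists p', (p - c * p').
    by split=> //; split; [apply: P_B => //; exact: P_Z|ring].
  have : PL a b (c * (q' * a) + q' * b).
    by apply: (submod_D HPL) => //; apply: (submod_Z HPL).
  have -> : c * (q' * a) + q' * b = q' * (c * a + b) by ring.
  case=> p [p' [Pp [Pp' ->]]]; exists p', (p - c * p').
  by split=> //; split; [apply: P_B => //; exact: P_Z|ring].
have [q [qa [qb nPL]]] := line_multiplier Pa Pb aNb bNa.
have {}qb : into q a.
  apply: (@line_into _ _ b) => //; first by move=> p Pp; exists 0, p; rewrite mulr0 add0r.
  by exists 1, 0, 0, 1; rewrite !mulr0 !mulr1 add0r addr0.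
(* The lines of [b] and [a + b] suffice to span [L]. *)
have [q0 [q0b nPL0]] := second 0 T0; have [q1 [q1b nPL1]] := second 1 T1.
have PLb := kills T0 qb q0b nPL0; have PLab := kills T1 qb q1b nPL1.
rewrite mul0r add0r in PLb; rewrite mul1r in PLab.
apply: nPL; split=> //.
have -> : q * a = q * (a + b) - q * b by ring.
exact: (submod_B HT HPL).
Qed.

End TwoGenerators.

(** Elements of [T] outside [P] are units of [D] times powers of [pi], and [P] is contained in [D].
    If neither [x] nor its inverse is in [T], numerator and denominator of [x] lie in [P] and are
    incomparable over [T]. *)
Lemma local_stable_valuation : valuation_ring D.
Proof.
have TD x : x != 0 -> T x -> D x \/ D x^-1.
  move=> x0 [n Dx]; have [/(_ n)|[k [e [E [De [e0 Dei]]]]]] := D_factor Dx.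
    by rewrite mulrAC divff ?mul1r //; left.
  have Ex : x = e * pi ^+ k / pi ^+ n by rewrite -E mulrAC divff ?mul1r.
  have [nk|/ltnW kn] := leqP n k.
    left; rewrite Ex -mulrA -(subnK nk) exprD mulfK //.
    by apply: subr_M => //; apply: D_piX.
  right; rewrite Ex -(subnK kn) exprD.
  have -> : (e * pi ^+ k / (pi ^+ (n - k) * pi ^+ k))^-1 = e^-1 * pi ^+ (n - k).
    by field; rewrite e0 !piX0.
  by apply: subr_M => //; apply: D_piX.
move=> x x0; have [/(TD _ x0)//|nTx] := EM (T x).
have [Tx|nTxi] := EM (T x^-1).
  by have [|Dx|] := TD _ _ Tx; [rewrite invr_eq0|right|rewrite invrK; left].
have [r [s [Dr [Ds [s0 Ex]]]]] := nonzero_fraction HD HQ x.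
exfalso; apply: (@incomparable_absurd r s).
- have [//|[k [e [E [De [e0 Dei]]]]]] := D_factor Dr; case: nTxi; exists k.
  have -> : pi ^+ k * x^-1 = e^-1 * s.
    have -> : pi ^+ k = e^-1 * r by rewrite E mulKf.
    by rewrite -Ex -!mulrA divff ?mulr1.
  exact: subr_M.
- have [//|[k [e [E [De [e0 Dei]]]]]] := D_factor Ds; case: nTx; exists k.
  have -> : pi ^+ k * x = e^-1 * r by rewrite -Ex E -mulrA mulKf.
  exact: subr_M.
- by move=> t Tt E; apply: nTx; have -> : x = t by apply: (mulfI s0); rewrite Ex.
- move=> t Tt E; apply: nTxi; have -> : x^-1 = t; last by [].
  have t0 : t != 0 by apply: contraNneq s0 => t0; rewrite E t0 mulr0.
  by apply: invr_inj; rewrite invrK; apply: (mulfI s0); rewrite Ex [in RHS]E mulfK.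
Qed.

End LocalStable.

(** * w-stable domains with t-invertible t-maximal ideals *)

Section TInvertible.
Local Open Scope ring_scope.
Variables (K : fieldType) (R : K -> Prop).
Hypotheses (HR : subring R) (HQ : quotient_field R).
Implicit Types (A B C I J E M N P : K -> Prop).

Lemma t_max_eq M N : t_max R M -> t_max R N -> subset M N -> seteq N M.
Proof. by move=> [_ [_ maxM]] [tiN [pN _]]; apply: maxM. Qed.

Lemma t_max_separate M N : t_max R M -> t_max R N -> ~ seteq N M ->
  exists s, M s /\ cpl R N s.
Proof.
move=> tM tN neNM; apply: contrapT => nos; apply: neNM; apply: t_max_eq => // s Ms.
apply: contrapT => nNs; apply: nos; exists s; do 2!split=> //.
by apply: prime_sub Ms; apply: t_max_prime.
Qed.

(** Stability of the w-ideal [I' = I] intersected with [R] is transported to [I], since every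
    element of [I] is one of [I'] up to a unit of [R_M]. *)
Lemma w_stable_localization M : w_stable R -> t_max R M ->
  forall I, submodule (ext R M R) I -> nonzero I -> subset I (ext R M R) ->
  prod I (colon (Eend I) I) 1.
Proof.
move=> stR tM I HI [i [Ii i0]] ID; have HM := t_max_prime HR tM.
have RD := sub_ext HR HM (I := R).
have Idiv s z : cpl R M s -> I (s * z) -> I z.
  move=> Ms Iz; have -> : z = s^-1 * (s * z) by rewrite mulKf // (cpl_neq0 HM Ms).
  by apply: (submod_Z HI) => //; apply: ext_inv.
pose I' z := R z /\ I z.
have HI' : submodule R I'.
  split; first by split; [exact: subr_0|exact: submod_0 HI].
  split=> [u v [Ru Iu] [Rv Iv]|r v Rr [Rv Iv]]; split.
  - exact: subr_D.
  - exact: (submod_D HI).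
  - exact: subr_M.
  - by apply: (submod_Z HI) => //; apply: RD.
have to_I' z : I z -> exists s, cpl R M s /\ I' (s * z).
  move=> Iz; have [s [Ms Rz]] := ID z Iz; exists s; do 2!split=> //.
  by apply: (submod_Z HI) => //; apply: RD; case: Ms.
have wI' : w_ideal R I'.
  apply/(w_idealE HR).
    apply: ideal_frac => //; first by split=> // z [].
    have [s [Ms I's]] := to_I' i Ii; exists (s * i); split=> //.
    by rewrite mulf_neq0 // (cpl_neq0 HM Ms).
  move=> z wz; split; last by have [s [Ms [_ /(Idiv _ _ Ms)]]] := wz M tM.
  by apply: (wcl_ring HR HQ); apply: wcl_mono wz => y [].
have [s [Ms]] := (w_stableE HR wI').1 (stR I' wI') M tM; rewrite mulr1 => Ps.
have -> : 1 = s^-1 * s by rewrite mulVf // (cpl_neq0 HM Ms).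
apply: (submod_Z (prod_submodule _ HI)); first exact: ext_inv.
apply: prod_mono Ps => [z []//|y Ey a Ia b Ib].
have [t [Mt I'a]] := to_I' a Ia; have [u [Mu I'b]] := to_I' b Ib.
apply: (Idiv (t * u)); first exact: cplM.
have -> : t * u * (y * a * b) = y * (t * a) * (u * b) by ring.
by have [] := Ey _ I'a _ I'b.
Qed.

Hypothesis stR : w_stable R.
Hypothesis invR : forall M, t_max R M -> t_invertible R M.

Lemma t_max_generator M : t_max R M ->
  exists a y, M a /\ colon R M y /\ cpl R M (a * y).
Proof.
move=> tM; have wM := (t_ideal_w_ideal HR HQ tM.1).1.
exact: (t_invertibleE HR wM).1 (invR tM) M tM.
Qed.

Lemma t_invertible_PvMD : PvMD R.
Proof.
move=> M tM; have HM := t_max_prime HR tM.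
have [pi [y [Mpi [My Mpiy]]]] := t_max_generator tM.
have pi0 : pi != 0.
  by apply: contraNneq (cpl_neq0 HM Mpiy) => ->; rewrite mul0r.
suff V : valuation_ring (ext R M R).
  by move=> x /V [Vx|Vx]; [left|right]; apply/(locE HM).
have RD := sub_ext HR HM (I := R).
apply: (@local_stable_valuation _ _ pi) => //.
- exact: ext_subring.
- by move=> x; have [a [b [Ra [Rb Ex]]]] := HQ x; exists a, b; do 2?split; auto.
- exact/RD/(prime_sub HM).
- move=> [s [[Rs nMs] Rspi]]; apply: nMs; rewrite -(divfK pi0 s).
  exact: (prime_Z HM).
- move=> d [s [Ms Rsd]]; have [Msd|nMsd] := EM (M (s * d)).
    (* As [y] sends [M] into [R], the unit [s (pi y)] is a denominator of [d / pi]. *)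
    left; exists (s * (pi * y)); split; first exact: cplM.
    have -> : s * (pi * y) * (d / pi) = y * (s * d) by field.
    exact: My.
  right; have d0 : d != 0.
    by apply/eqP => d0; apply: nMsd; rewrite d0 mulr0; apply: prime_0 HM.
  by split=> //; exists (s * d); rewrite mulfK //; split=> //; case: Ms.
- exact: w_stable_localization.
Qed.

(* Let [I] be the sum of the [(R : M)] over the t-maximal [M] containing [x].  It
   is locally principal, so [E(I_w) = R] and w-stability makes [I] t-invertible;
   as [I] is then contained in the t-closure of a finite subsum, only finitely
   many [M] occur. *)
Lemma t_invertible_t_finite_character : t_finite_character R.
Proof.
move=> x Rx x0.
have [[M0 [tM0 M0x]]|noM] := EM (exists M, t_max R M /\ M x); last first.
  by exists 0%N, (fun=> R) => M tM Mx; case: noM; exists M.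
pose U y := exists M, t_max R M /\ M x /\ colon R M y.
pose I := prod R U.
have HI : submodule R I by apply: prod_submodule; apply: subring_submodule.
have UI : subset U I.
  by move=> u Uu; rewrite -[u]mul1r; apply: prod_mul => //; apply: subr_1.
have I1 : I 1.
  apply: UI; exists M0; do 2!split=> //; move=> m Mm; rewrite mul1r.
  exact: prime_sub (t_max_prime HR tM0) _ Mm.
have xI : colon R I x.
  move=> z; apply: (prod_sub (C := fun z => R (x * z))) => [|u v|r u Rr [M [tM [Mx Mu]]]].
  - by rewrite mulr0; apply: subr_0.
  - by rewrite mulrDr; apply: subr_D.
  - by rewrite mulrCA (mulrC x); apply: subr_M => //; apply: Mu.
(* In [R_N] the summands [(R : M)] with [M] different from [N] become integral, so [N I] is
   contained in [R_N]. *)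
have local N a z : t_max R N -> N a -> N x -> I z -> ext R N R (a * z).
  move=> tN Na Nx; have HN := t_max_prime HR tN.
  have HE := ext_submodule HR HN (subring_submodule HR).
  apply: (prod_sub (C := fun z => ext R N R (a * z))) => [|u v|r u Rr [M [tM [Mx Mu]]]].
  - by rewrite mulr0; apply: submod_0 HE.
  - by rewrite mulrDr; apply: (submod_D HE).
  rewrite mulrCA; apply: (submod_Z HE) => //.
  have [/(_ a)[/(_ Na) Ma _]|neNM] := EM (seteq N M).
    by apply: sub_ext => //; rewrite mulrC; apply: Mu.
  have [s [Ms Ns]] := t_max_separate tM tN neNM.
  exists s; split=> //; have -> : s * (a * u) = a * (u * s) by ring.
  by apply: (subr_M HR); [exact: prime_sub HN _ Na|exact: Mu].
pose W := wcl R I.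
have HW : submodule R W by apply: wcl_submodule.
have IW : subset I W by apply: sub_wcl.
have wW : w_ideal R W.
  apply/(w_idealE HR); last exact: wcl_idem.
  split=> //; split; first by exists 1; split; [exact: IW|exact: oner_neq0].
  exists x; do 2!split=> //; move=> z wz; apply: (wcl_ring HR HQ) => N tN.
  have [s [Ns Isz]] := wz N tN; exists s; split=> //.
  by rewrite mulrCA; apply: xI.
(* At [N] containing [x], test [z] on the local inverse [y] of a generator of [N]; elsewhere [x] is
   a unit and [x I] lies in [R]. *)
have EW : subset (Eend W) R.
  move=> z Ez; apply: (wcl_ring HR HQ) => N tN; have HN := t_max_prime HR tN.
  have [Nx|nNx] := EM (N x).
    have [a [y [Na [Ny Nay]]]] := t_max_generator tN.
    have Iy : I y by apply: UI; exists N.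
    apply: (ext_div HR HN Nay).
    have -> : a * y * z = a * (z * y) by ring.
    have [s [Ns Iszy]] := Ez y (IW _ Iy) N tN.
    by apply: (ext_div HR HN Ns); rewrite mulrCA; apply: local.
  have [s [Ns Isz]] := Ez 1 (IW _ I1) N tN.
  apply: (ext_div HR HN Ns); exists x; split=> //.
  by apply: xI; rewrite -[z]mulr1.
have IcR a b : I a -> colon R I b -> R (a * b) by move=> Ia Ib; rewrite mulrC; apply: Ib.
have [s [sI s1]] : tcl R (prod I (colon R I)) 1.
  apply: t_max_covers => //.
  - split; first exact: prod_submodule.
    by apply: prod_sub => //; [exact: subr_0|exact: subr_D].
  - by exists (1 * x); split; [exact: prod_mul|rewrite mul1r].
  move=> N tN; have HN := t_max_prime HR tN.
  have [s [[_ nNs] Ps]] := (w_stableE HR wW).1 (stR wW) N tN.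
  rewrite mulr1 in Ps.
  have [|w [y [Ww [Ey Nwy]]]] := prod_cpl HN _ Ps nNs.
    by move=> w y Ww Ey; rewrite mulrC; apply/EW/Ey.
  have [t [Nt Itw]] := Ww N tN; exists (t * w * y); split.
    by apply: prod_mul => // b /IW /Ey /EW.
  by rewrite -mulrA; case: (cplM HR HN Nt Nwy).
(* [almost Q]: among the t-maximal ideals containing [x], [Q] can fail only at those in a finite
   list. The default of [nth] is never reached. *)
pose almost (Q : (K -> Prop) -> Prop) := exists l : seq (K -> Prop),
  forall N, t_max R N -> N x ->
  (forall i, (i < size l)%N -> ~ seteq N (nth R l i)) -> Q N.
have almost2 (Q1 Q2 Q : (K -> Prop) -> Prop) :
    (forall N, t_max R N -> Q1 N -> Q2 N -> Q N) -> almost Q1 -> almost Q2 -> almost Q.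
  move=> QQ [l1 Q1l] [l2 Q2l]; exists (l1 ++ l2) => N tN Nx nN; apply: QQ => //.
    apply: Q1l => // i il; have := nN i; rewrite nth_cat il; apply.
    by rewrite size_cat ltn_addr.
  apply: Q2l => // i il; have := nN (size l1 + i)%N.
  by rewrite nth_cat size_cat ltn_add2l [(_ + _ < _)%N]ltnNge leq_addr /= addKn; apply.
(* A term [u y] with [u] in [(R : M)] lies in every [N] other than [M] that contains [x]: [u] is
   integral at [N], and [y] is a multiple of the local generator [c] because [y z] is in [R]. *)
have almost_mem j : prod I (colon R I) j -> almost (fun N => N j).
  apply: (prod_sub (C := fun j => almost (fun N => N j))) => [|u v|a y Ia Ey].
  - by exists [::] => N tN _ _; apply: prime_0 (t_max_prime HR tN).
  - by apply: almost2 => N tN; apply: prime_D (t_max_prime HR tN) _ _.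
  move: Ia; apply: (prod_sub (C := fun a => almost (fun N => N (a * y)))) => [|u v|r u Rr Uu].
  - exists [::] => N tN _ _; rewrite mul0r.
    exact: prime_0 (t_max_prime HR tN).
  - apply: almost2 => N tN; rewrite mulrDl.
    exact: prime_D (t_max_prime HR tN) _ _.
  have [M [tM [Mx Mu]]] := Uu; exists [:: M] => N tN Nx /(_ 0%N isT) /= neNM.
  have HN := t_max_prime HR tN; rewrite -mulrA; apply: (prime_Z HN) => //.
  have [c [z [Nc [Nz Ncz]]]] := t_max_generator tN.
  have [t [Mt Nt]] := t_max_separate tM tN neNM.
  have Iz : I z by apply: UI; exists N.
  have Ruy : R (u * y) by apply: IcR => //; apply: UI.
  apply: contrapT => nNuy.
  case: (cplM HR HN (cplM HR HN Ncz Nt) (conj Ruy nNuy)) => _; apply.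
  have -> : c * z * t * (u * y) = u * t * (y * z) * c by ring.
  by apply: (prime_Z HN) => //; apply: (subr_M HR); [exact: Mu|exact: Ey].
have [l Hl] : almost (fun N => forall j, j \in s -> N j).
  elim: s sI {s1} => [_|j s IH sI]; first by exists [::].
  apply: almost2 (almost_mem _ (sI _ (mem_head j s))) (IH _) => [N _ Nj Ns i|i si].
    by rewrite inE => /orP[/eqP->|/Ns].
  by apply: sI; rewrite inE si orbT.
exists (size l), (fun i => nth R l i) => N tN Nx; apply: contrapT => nN.
apply: (t_max_no_unit HR tN (A := N)) => //; exists s; split=> //.
by apply: Hl => // i il NM; apply: nN; exists (Ordinal il).
Qed.

End TInvertible.

(** * Strongly discrete PvMDs with t-finite character *)

Section StronglyDiscrete.
Local Open Scope ring_scope.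
Variables (K : fieldType) (R : K -> Prop).
Hypotheses (HR : subring R) (HQ : quotient_field R).
Hypothesis sdR : strongly_discrete R.
Implicit Types (A B C I J E M N P : K -> Prop).

Let VR : PvMD R := sdR.1.

(** At [N] not containing [P], use an element of [P] outside [N]. Otherwise [P R_N] is divisible by
    any element outside [P], so the denominator [s] from [M] is absorbed into one factor. *)
Lemma idempotent_at_t_max P M : t_prime R P -> t_max R M -> subset P M ->
  subset P (ext R M (prod P P)) -> subset P (tcl R (prod P P)).
Proof.
move=> [HP tiP] tM PM PP p Pp; have [[HsP PR] [[q [Pq q0]] _]] := tiP.
have HPP := prod_submodule P HsP.
apply: (wcl_sub_tcl HR HQ HPP).
  by exists (q * q); split; [exact: prod_mul|rewrite mulf_neq0].
move=> N tN; have HN := t_max_prime HR tN.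
have [[r [Pr nNr]]|nPN] := EM (exists r, P r /\ ~ N r).
  by exists r; split; [split=> //; exact: PR|exact: prod_mul].
have PN : subset P N by move=> r Pr; apply: contrapT => nNr; apply: nPN; exists r.
have [s [[Rs nMs] PPsp]] := PP p Pp.
have s0 : s != 0 by apply/eqP => s0; apply/nMs/PM; rewrite s0; apply: submod_0 HsP.
have Ps r : P r -> ext R N P (r / s).
  move=> Pr; have [[u [a [Nu [Ra E]]]]|[u [a [[Ru nNu] [Na E]]]]] := PvMD_compare HR VR tN r s.
    exists u; split=> //; rewrite mulrA E mulfK //.
    have : P (a * s) by rewrite -E; apply: (submod_Z HsP) => //; case: Nu.
    by case/(HP.2.2 a s Ra Rs) => // /PM.
  have : P (u * s) by rewrite E; apply: (submod_Z HsP) => //; apply: prime_sub HN _ Na.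
  by case/(HP.2.2 u s Ru Rs) => [/PN|/PM].
have HE := ext_submodule HR HN HPP.
have -> : p = s * p / s by rewrite mulrAC divff ?mul1r.
apply: (prod_sub (C := fun z => ext R N (prod P P) (z / s))) PPsp => [|u v|a b Pa Pb].
- by rewrite mul0r; apply: submod_0 HE.
- by rewrite mulrDl; apply: (submod_D HE).
- rewrite mulrAC; apply: (ext_mul HR HN _ (Ps _ Pa) (sub_ext HR HN Pb)) => z w.
  exact: prod_mul.
Qed.

Lemma prime_not_idempotent P M : t_max R M -> prime_ideal R P -> nonzero P ->
  subset P M -> exists n, P n /\ ~ ext R M (prod P P) n.
Proof.
move=> tM HP P0 PM; have tP := sub_t_max_t_prime HR VR tM HP P0 PM.
have [_ /(_ P tP) nPP] := (strongly_discreteE HR).1 sdR.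
apply: contrapT => non; apply/nPP/(idempotent_at_t_max tP tM PM) => n Pn.
by apply: contrapT => nn; apply: non; exists n.
Qed.

(** Over a valuation ring [a b] divides [a a] or [b b], and the radical property removes the
    square. *)
Lemma radical_ext_prime I M a b : submodule R I -> subset I R -> radical R I -> t_max R M ->
  R a -> R b -> ext R M I (a * b) -> ext R M I a \/ ext R M I b.
Proof.
move=> HI IR radI tM Ra Rb Iab; have HM := t_max_prime HR tM.
have HE := ext_submodule HR HM HI.
have sq z : R z -> ext R M I (z * z) -> ext R M I z.
  move=> Rz [s [Ms Is]]; have Rs : R s by case: Ms.
  exists s; split=> //; apply: (radI _ 1%N); first exact: subr_M.
  have -> : (s * z) ^+ 2 = s * (s * (z * z)) by ring.
  exact: (submod_Z HI).
have [[u [r [Mu [Rr E]]]]|[u [r [Mu [/(prime_sub HM) Rr E]]]]] := PvMD_compare HR VR tM a b.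
  left; apply: sq => //; apply: (ext_div HR HM Mu).
  by rewrite mulrA E -mulrA (mulrC b); apply: (submod_Z HE).
right; apply: sq => //; apply: (ext_div HR HM Mu).
by rewrite mulrA E -mulrA; apply: (submod_Z HE).
Qed.

Lemma chain_mono (I : nat -> K -> Prop) : (forall n, subset (I n) (I n.+1)) ->
  forall m n, (m <= n)%N -> subset (I m) (I n).
Proof.
move=> incI m n /subnK <-; elim: (n - m)%N => [//|k IH] x /IH Ix.
exact: incI.
Qed.

(** Unless it contains [1], the union [U] of the contracted localizations is a prime inside [M], so
    some [y] in [U] is outside [U U R_M]; let [I k] contain it locally. If [z] in [I m] is not a
    multiple of [y], then [y] is [r z] up to a unit; primality puts [z] or [r] in [I k] locally, and
    [r] would give [y] in [U U R_M]. *)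
Lemma radical_chain_local (I : nat -> K -> Prop) M : t_max R M ->
  (forall n, t_ideal R (I n) /\ radical R (I n)) ->
  (forall n, subset (I n) (I n.+1)) ->
  exists k, forall m, subset (I m) (ext R M (I k)).
Proof.
move=> tM HI incI; have HM := t_max_prime HR tM.
have leI := chain_mono incI.
have HsI n : submodule R (I n) by have [[[]]] := HI n.
have IR n : subset (I n) R by have [[[]]] := HI n.
have HE n := ext_submodule HR HM (HsI n).
have leE m n : (m <= n)%N -> subset (ext R M (I m)) (ext R M (I n)).
  by move=> mn; apply: ext_mono; apply: leI.
pose U z := R z /\ exists n, ext R M (I n) z.
have [[_ [k U1]]|nU1] := EM (U 1).
  by exists k => m z /IR Rz; rewrite -[z]mulr1; apply: (submod_Z (HE k)).
have HU : prime_ideal R U.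
  split; [split|split=> //].
  - split; first by split; [exact: subr_0|exists 0%N; exact: submod_0 (HE _)].
    split=> [x y [Rx [m Ux]] [Ry [n Uy]]|r x Rr [Rx [n Ux]]]; split.
    + exact: subr_D.
    + exists (maxn m n); apply: (submod_D (HE _)).
        exact: leE (leq_maxl _ _) _ Ux.
      exact: leE (leq_maxr _ _) _ Uy.
    + exact: subr_M.
    + by exists n; apply: (submod_Z (HE _)).
  - by move=> z [].
  - move=> x y Rx Ry [_ [n Uxy]].
    have [Ux|Uy] := radical_ext_prime (HsI n) (IR n) (HI n).2 tM Rx Ry Uxy.
      by left; split=> //; exists n.
    by right; split=> //; exists n.
have U0 : nonzero U.
  have [[_ [[x [Ix x0]] _]] _] := HI 0%N; exists x; split=> //.
  by split; [exact: IR Ix|exists 0%N; exact: sub_ext].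
have UM : subset U M.
  move=> z [Rz [n Uz]]; apply: contrapT => nMz; apply: nU1; split; first exact: subr_1.
  by exists n; apply: (ext_div HR HM (conj Rz nMz)); rewrite mulr1.
have [y [[Ry [k Uy]] nUUy]] := prime_not_idempotent tM HU U0 UM.
exists k => m z Iz; have Rz := IR m z Iz.
have [[u [r [Mu [Rr E]]]]|[u [r [Mu [/(prime_sub HM) Rr E]]]]] := PvMD_compare HR VR tM y z.
  have [|//|Ur] := @radical_ext_prime (I k) M z r (HsI k) (IR k) (HI k).2 tM Rz Rr.
    by rewrite mulrC -E; apply: (submod_Z (HE k)) => //; case: Mu.
  case: nUUy; apply: (ext_div HR HM Mu); rewrite E.
  apply: sub_ext => //; apply: prod_mul; split=> //; first by exists k.
  by exists m; apply: sub_ext.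
by apply: (ext_div HR HM Mu); rewrite E; apply: (submod_Z (HE k)).
Qed.

Lemma seteq_eq A B : seteq A B -> A = B.
Proof. by move=> AB; apply: funext => x; apply: propext. Qed.

Hypothesis fcR : t_finite_character R.

(** A nonzero [x] in [I 0] is a unit in all but finitely many [R_M], so the local stages have a
    maximum. *)
Lemma t_finite_acc_radical_t : acc_radical_t R.
Proof.
move=> I HI incI; have [[_ IR0] [[x [Ix x0]] _]] := (HI 0%N).1.
have leI := chain_mono incI.
have [n [f fP]] := fcR (IR0 x Ix) x0.
have /choice [g gP] : forall i, exists k, t_max R (f i) ->
    forall m, subset (I m) (ext R (f i) (I k)).
  move=> i; have [tf|ntf] := EM (t_max R (f i)); last by exists 0%N.
  by have [k kP] := radical_chain_local tf HI incI; exists k.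
exists (\max_(i < n) g i) => m lem z; split; last exact: leI.
move=> Iz; apply: (t_ideal_wcl HR HQ (HI _).1) => M tM.
have [Mx|nMx] := EM (M x).
  have [i /seteq_eq EM] := fP M tM Mx; rewrite EM in tM *.
  by apply: ext_mono (gP i tM _ _ Iz); apply: leI; apply: leq_bigmax.
have [[[_ IR] _] _] := HI m; have [[[HsI _] _] _] := HI 0%N.
exists x; split; first by split=> //; apply: IR0.
apply: (leI 0%N) => //; rewrite mulrC; apply: (submod_Z HsI) => //.
exact: IR Iz.
Qed.

(* Says that [I R_M = c B] for the overring [B = E(I R_M)]: otherwise
   [I R_M = Q B I R_M], where [Q B] is the maximal ideal of [B], which is
   principal because [Q] is not idempotent. *)
Lemma frac_ideal_local_principal I M : frac_ideal R I -> t_max R M ->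
  exists c, I c /\ c != 0 /\ forall i j, I i -> I j -> ext R M I (i * j / c).
Proof.
move=> [HI [[i0 [Ii0 i00]] [d [Rd [d0 dI]]]]] tM; have HM := t_max_prime HR tM.
have HE := ext_submodule HR HM HI.
(* Invertibility of [r] in [B = E(I R_M)], for [r] in [R]. *)
pose unitB r := r != 0 /\ forall i, I i -> ext R M I (i / r).
have unitB_factor r s : R r -> unitB (r * s) -> unitB s.
  move=> Rr [rs0 Brs]; move: (rs0); rewrite mulf_eq0 negb_or => /andP [r0 s0].
  split=> // i /Brs Irs; have -> : i / s = r * (i / (r * s)) by field; rewrite s0.
  exact: (submod_Z HE).
have unitBM r s : unitB r -> unitB s -> unitB (r * s).
  move=> [r0 Br] [s0 Bs]; split=> [|i /Br [u [Mu /Bs Iu]]]; first by rewrite mulf_neq0.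
  apply: (ext_div HR HM Mu).
  by have -> : u * (i / (r * s)) = u * (i / r) / s by field; rewrite s0.
have unitB_cpl s : cpl R M s -> unitB s.
  move=> Ms; have s0 := cpl_neq0 HM Ms; split=> // i Ii; exists s; split=> //.
  by rewrite mulrCA divff ?mulr1.
have unitB_div r i : unitB r -> ext R M I i -> ext R M I (i / r).
  move=> [r0 Br] [s [Ms /Br Isr]]; apply: (ext_div HR HM Ms).
  by rewrite mulrA.
pose Q r := R r /\ ~ unitB r.
have QM : subset Q M.
  by move=> r [Rr nr]; apply: contrapT => nMr; apply/nr/unitB_cpl.
have Q_D r s : Q r -> Q s -> Q (r + s).
  move=> [Rr nr] [Rs ns]; split; first exact: subr_D.
  move=> Brs.
  have [[u [a [Mu [Ra E]]]]|[u [a [Mu [/(prime_sub HM) Ra E]]]]] := PvMD_compare HR VR tM r s.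
    apply: ns; apply: (@unitB_factor (a + u)); first by apply: subr_D => //; case: Mu.
    have -> : (a + u) * s = u * (r + s) by rewrite mulrDl -E; ring.
    exact: unitBM (unitB_cpl _ Mu) Brs.
  apply: nr; apply: (@unitB_factor (a + u)); first by apply: subr_D => //; case: Mu.
  have -> : (a + u) * r = u * (r + s) by rewrite mulrDl -E; ring.
  exact: unitBM (unitB_cpl _ Mu) Brs.
have HQp : prime_ideal R Q.
  split; [split|split].
  - split; first by split=> [|[]]; [exact: subr_0|rewrite eqxx].
    split=> // r s Rr [Rs ns]; split; first exact: subr_M.
    by move/(unitB_factor _ _ Rr).
  - by move=> r [].
  - by move=> [_]; apply; apply: unitB_cpl; apply: cpl1.
  - move=> r s Rr Rs [_ nrs]; apply: contrapT => /not_orP [nQr nQs].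
    apply: nrs; apply: unitBM; apply: contrapT => nB; [apply: nQr|apply: nQs];
    by split.
(* If [d i0 m] were invertible in [B], then [1 / (d m)] would lie in [I R_M], and [d I] being in [R]
   would make [m] a unit of [R_M]. *)
have Q0 : nonzero Q.
  have [[[_ MR] [[m [Mm m0]] _]] _] := tM.
  have r0 : d * i0 * m != 0 by rewrite !mulf_neq0.
  exists (d * i0 * m); split=> //; split; first by apply: subr_M; [|exact: dI|exact: MR].
  move=> [_ /(_ _ Ii0) [s [[Rs nMs] Is]]]; apply: nMs.
  have -> : s = d * (s * (i0 / (d * i0 * m))) * m by field; rewrite m0 i00.
  by apply: (prime_Z HM) => //; apply: dI.
have [n [[Rn nBn] nQQn]] := prime_not_idempotent tM HQp Q0 QM.
have HQQ := ext_submodule HR HM (prod_submodule Q HQp.1.1).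
have n0 : n != 0 by apply/eqP => n0; apply: nQQn; rewrite n0; apply: submod_0 HQQ.
(* [n] generates [Q B]: if instead [n] is [a q] up to a unit of [R_M], then [a] is invertible in
   [B], as otherwise [n] would lie in [Q Q R_M]. *)
have Q_div q i : Q q -> ext R M I i -> ext R M I (q * i / n).
  move=> Qq Ii; have Rq : R q by case: Qq.
  have [[u [a [Mu [Ra E]]]]|[u [a [Mu [Ma E]]]]] := PvMD_compare HR VR tM q n.
    apply: (ext_div HR HM Mu).
    have -> : u * (q * i / n) = a * i by rewrite !mulrA E; field.
    exact: (submod_Z HE).
  have Ra := prime_sub HM Ma.
  have Ba : unitB a.
    apply: contrapT => nBa; apply: nQQn; apply: (ext_div HR HM Mu); rewrite E.
    by apply: sub_ext => //; apply: prod_mul.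
  have [a0 _] := Ba; have Ru : R u by case: Mu.
  have -> : q * i / n = u * i / a.
    by apply: (mulIf (mulf_neq0 n0 a0)); transitivity (a * q * i); [field|rewrite -E; field].
  by apply: unitB_div => //; apply: (submod_Z HE).
(* Choose [c] outside [n I R_M]. If [c] were [a i] up to a unit of [R_M] with [a] in [Q], [Q_div]
   would put it there. *)
have [c [Ic ncn]] : exists c, I c /\ ~ ext R M I (c / n).
  apply: contrapT => nc; apply: nBn; split=> // c Ic.
  by apply: contrapT => ncn; apply: nc; exists c.
have c0 : c != 0 by apply/eqP => c0; apply: ncn; rewrite c0 mul0r; apply: submod_0 HE.
exists c; do 2!split=> //; move=> i j Ii Ij; have IEj := sub_ext HR HM Ij.
have [[u [a [Mu [Ra E]]]]|[u [a [Mu [/(prime_sub HM) Ra E]]]]] := PvMD_compare HR VR tM i c.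
  apply: (ext_div HR HM Mu).
  have -> : u * (i * j / c) = a * j by rewrite !mulrA E; field.
  exact: (submod_Z HE).
have Ru : R u by case: Mu.
have [Ba|nBa] := EM (unitB a).
  have [a0 _] := Ba; have -> : i * j / c = u * j / a.
    by apply: (mulIf (mulf_neq0 c0 a0)); transitivity (a * i * j); [field|rewrite -E; field].
  by apply: unitB_div => //; apply: (submod_Z HE).
case: ncn; apply: (ext_div HR HM Mu); rewrite mulrA E.
by apply: Q_div => //; apply: sub_ext.
Qed.

(* With [c] generating [I R_M] as above, the inverse of [I] over [E(I)] contains
   [s / c] for some [s] outside [M]; finite character provides a common [s]. *)
Lemma t_finite_w_stable : w_stable R.
Proof.
move=> I wI; apply/(w_stableE HR wI) => M tM; have HM := t_max_prime HR tM.
have [fI _] := wI; have [HI [_ [d [Rd [d0 dI]]]]] := fI.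
have [c [Ic [c0 cP]]] := frac_ideal_local_principal fI tM.
have [n [f fP]] := fcR (dI c Ic) (mulf_neq0 d0 c0).
(* Here [e] is the local generator at [f k] and [t] clears [e e / c] at [M]; then
   [t i j / c = (i j / e) (t e e / c) / e] is in the localization of [I] at [f k]. *)
have /choice [g gP] : forall k, exists t, cpl R M t /\ (t_max R (f k) ->
    forall i j, I i -> I j -> ext R (f k) I (t * (i * j / c))).
  move=> k; have [tN|ntf] := EM (t_max R (f k)); last by exists 1; split=> //; exact: cpl1.
  have HN := t_max_prime HR tN; have [e [Ie [e0 eP]]] := frac_ideal_local_principal fI tN.
  have [t [Mt It]] := cP e e Ie Ie; exists t; split=> // _ i j Ii Ij.
  have [u [Nu Iu]] := eP i j Ii Ij; apply: (ext_div HR HN Nu).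
  have -> : u * (t * (i * j / c)) = u * (i * j / e) * (t * (e * e / c)) / e.
    by field; rewrite e0 c0.
  exact: eP.
pose s := \prod_(k < n) g k.
have Ms : cpl R M s.
  apply: (big_ind (cpl R M)) => [|x y|k _]; first exact: cpl1.
    exact: cplM.
  by case: (gP k).
have Es : colon (Eend I) I (s / c).
  move=> i Ii j Ij; apply: ((w_idealE HR fI).1 wI) => N tN.
  have HN := t_max_prime HR tN; have HE := ext_submodule HR HN HI.
  have [Nx|nNx] := EM (N (d * c)).
    have [k /seteq_eq EN] := fP N tN Nx; rewrite EN in tN HE *.
    have -> : s / c * i * j = \prod_(l < n | l != k) g l * (g k * (i * j / c)).
      by rewrite /s (bigD1 k) //=; ring.
    apply: (submod_Z HE); last by apply: (gP k).2.
    apply: (big_ind R) => [|x y|l _]; [exact: subr_1|exact: subr_M|].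
    by case: (gP l) => -[].
  have Nx : cpl R N (d * c) by split=> //; apply: dI.
  apply: (ext_div HR HN Nx).
  have -> : d * c * (s / c * i * j) = s * (d * i) * j by field.
  apply: sub_ext => //; apply: (submod_Z HI) => //.
  by apply: (subr_M HR); [case: Ms|exact: dI].
exists s; split=> //; rewrite mulr1 -(divfK c0 s) mulrC.
exact: prod_mul.
Qed.

End StronglyDiscrete.

(** * The cycle of seven implications *)

Theorem theorem2p6 (K : fieldType) (R : K -> Prop)
  (HR : subring R) (HQ : quotient_field R) (HKR : exists x, ~ R x) :
  [<-> integrally_closed R /\ w_stable R;
       w_stable R /\ PvMD R;
       strongly_discrete R /\ t_finite_character R;
       gen_Krull R /\ t_finite_character R;
       w_stable R /\ gen_Krull R;
       PvMD R /\ t_finite_character R /\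
         (forall P, t_prime R P -> w_stable_ideal R P);
       w_stable R /\ (forall M, t_max R M -> t_invertible R M)].
Proof.
have sd_of_primes : PvMD R -> (forall P, t_prime R P -> w_stable_ideal R P) ->
    strongly_discrete R.
  move=> VR stP; apply/(strongly_discreteE HR); split=> // P tP.
  by apply: w_stable_prime_not_idempotent => //; apply: stP.
have t_primes_stable : w_stable R -> forall P, t_prime R P -> w_stable_ideal R P.
  by move=> stR P [_ tiP]; apply/stR/t_ideal_w_ideal.
have fc_of_stable : w_stable R -> PvMD R -> t_finite_character R.
  move=> stR VR; apply: t_invertible_t_finite_character => //.
  exact: w_stable_PvMD_t_invertible.
tfae.
- by move=> [icR stR]; split=> //; apply: integrally_closed_PvMD.
- by move=> [stR VR]; split; [apply: sd_of_primes; auto|exact: fc_of_stable].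
- by move=> [sdR fcR]; do 2!split=> //; apply: t_finite_acc_radical_t.
- by move=> [[sdR accR] fcR]; split=> //; apply: t_finite_w_stable.
- by move=> [stR [[VR _] _]]; do 2!split=> //; auto.
- move=> [VR [fcR stP]]; have stR : w_stable R.
    by apply: t_finite_w_stable => //; apply: sd_of_primes.
  by split=> //; apply: w_stable_PvMD_t_invertible.
- move=> [stR invR]; split=> //.
  by apply: PvMD_integrally_closed => //; apply: t_invertible_PvMD.
Qed.
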